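(* Let $\mu$ be a probability measure on $\Gamma=\mathcal{Z}_r\wr\mathcal{G}$ which is irreducible (i.e. $\operatorname{supp}(\mu)$ generates $\Gamma$ as a semigroup), and assume that the lamplighter operates at bounded range (i.e. $R(\mu)<\infty$). Then the Dirichlet problem at infinity for continuous functions on $\overline{\Pi}=\hat{\mathcal{C}}\times\partial\mathbb{T}$ is solvable: for every continuous function $f:\overline{\Pi}\to\mathbb{R}$, the function $h(g)=\int_{\overline{\Pi}} f\,d\nu_g$, $g\in\Gamma$, is harmonic on $\Gamma$ and satisfies $\lim_{g\to\beta}h(g)=f(\beta)$ for every $\beta\in\overline{\Pi}$, where $g\to\beta$ with $g\in\Gamma$ in the topology of $\hat{\mathcal{C}}\times\hat{\mathbb{T}}$; in particular every continuous function on $\overline{\Pi}$ extends continuously to a function on $\Gamma\cup\overline{\Pi}$ that is harmonic on $\Gamma$.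
   Context: Let $q\ge 2$ and $r\ge 2$ be integers. $\mathbb{T}=\mathbb{T}_q$ is the homogeneous tree in which every vertex has degree $q+1$, viewed as a Cayley graph of a finitely generated group $\mathcal{G}$ (a free product of two-element groups and infinite cyclic groups, with the standard generators); vertices of $\mathbb{T}$ are identified with elements of $\mathcal{G}$, so that $\mathcal{G}$ acts on $\mathbb{T}$ by left multiplication by graph automorphisms. The identity of $\mathcal{G}$ is denoted $o$ and is the root of $\mathbb{T}$; $d(\cdot,\cdot)$ denotes the graph metric of $\mathbb{T}$. Configurations: $\mathcal{Z}_r=\mathbb{Z}/r\mathbb{Z}$, $\mathcal{C}$ is the abelian group (under pointwise addition mod $r$) of finitely supported functions $\eta:\mathbb{T}\to\mathcal{Z}_r$, with zero element $\mathbf 0$, and $\hat{\mathcal{C}}=\mathcal{Z}_r^{\mathbb{T}}$ is the set of all functions $\zeta:\mathbb{T}\to\mathcal{Z}_r$, with the compact topology of pointwise convergence. For $x\in\mathcal{G}$, $T_x\zeta(y)=\zeta(x^{-1}y)$. The lamplighter group is $\Gamma=\mathcal{Z}_r\wr\mathcal{G}=\mathcal{C}\rtimes\mathcal{G}$ with product $(\eta,x)(\eta',x')=(\eta+T_x\eta',\,xx')$ and identity $\mathrm{id}=(\mathbf 0,o)$. Ends: an end of $\mathbb{T}$ is an equivalence class of geodesic rays, two rays being equivalent if their symmetric difference as sets is finite. $\partial\mathbb{T}$ is the set of ends and $\hat{\mathbb{T}}=\mathbb{T}\cup\partial\mathbb{T}$. For $w,z\in\hat{\mathbb{T}}$ let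 $(w|z)$ be the length of the common initial part of the geodesics from $o$ to $w$ and from $o$ to $z$. The metric $\rho(w,z)=q^{-(w|z)}$ for $w\ne z$, $\rho(w,w)=0$, makes $\hat{\mathbb{T}}$ a compact ultrametric space with $\mathbb{T}$ a dense discrete subset. Left multiplications by $x\in\mathcal{G}$ extend to homeomorphisms of $\hat{\mathbb{T}}$. Compactification: $\hat{\mathcal{C}}\times\hat{\mathbb{T}}$, with the product topology, is a compactification of $\Gamma=\mathcal{C}\times\mathbb{T}$, on which $\Gamma$ acts by homeomorphisms $(\eta,x)(\zeta,w)=(\eta+T_x\zeta,\,xw)$; $\overline{\Pi}=\hat{\mathcal{C}}\times\partial\mathbb{T}$ is a compact $\Gamma$-invariant subset. $\Gamma\cup\overline{\Pi}$ carries the topology induced from $\hat{\mathcal{C}}\times\hat{\mathbb{T}}$. Random walk: let $\mathbf g_1,\mathbf g_2,\dots$ be independent $\Gamma$-valued random variables with common distribution $\mu$. The right random walk with law $\mu$ starting at $g_0\in\Gamma$ is $Z_n=g_0\mathbf g_1\cdots\mathbf g_n$; its transition probabilities are $p(g,g')=\mu(g^{-1}g')$. The lamplighter operates at bounded range if $R(\mu)=\sup\bigl\{\min\{d(y,o),d(y,x)\}: (\eta,x)\in\Gamma,\ \mu(\eta,x)>0,\ y\in\operatorname{supp}(\eta)\bigr\}<\infty$. Under the hypotheses of the claim, $(Z_n)$ converges almost surely in $\hat{\mathcal{C}}\times\hat{\mathbb{T}}$ to an $\overline{\Pi}$-valued random variable $Z_\infty$. Let $\nu$ be the distribution of $Z_\infty$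 when $Z_0=\mathrm{id}$, a Borel probability measure on $\overline{\Pi}$, and for $g\in\Gamma$ let $\nu_g(U)=\nu(g^{-1}U)$ for Borel $U\subset\overline{\Pi}$ (the distribution of $Z_\infty$ when $Z_0=g$). A function $h:\Gamma\to\mathbb{R}$ is harmonic if $h(g)=\sum_{g'\in\Gamma}p(g,g')h(g')$ for all $g\in\Gamma$. *)

(* Defs.v *)
From HB Require Import structures.
From mathcomp Require Import all_boot all_order all_algebra.
From mathcomp Require Import finmap generic_quotient.
From mathcomp Require Import all_classical all_reals all_analysis.

Set Implicit Arguments.
Unset Strict Implicit.
Unset Printing Implicit Defensive.

Import Order.TTheory GRing.Theory Num.Theory.
Import numFieldNormedType.Exports.

Local Open Scope classical_set_scope.
Local Open Scope ring_scope.

(** The group: free product of [k] two-element groups and [l] infinite cyclic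
    groups, realised as reduced words over the symmetric set of standard
    generators.  [inl i] is the involution generating the i-th two-element
    factor, [inr (j, b)] is the generator of the j-th infinite cyclic factor
    ([b = true]) or its inverse ([b = false]). *)
Definition letter (k l : nat) : Type := ('I_k + 'I_l * bool)%type.

HB.instance Definition _ k l := Finite.on (letter k l).

Definition linv k l (a : letter k l) : letter k l :=
  match a with inl i => inl i | inr (j, b) => inr (j, ~~ b) end.

Definition reduced k l (w : seq (letter k l)) : bool :=
  sorted (fun a b => b != linv a) w.

Record tree (k l : nat) :=
  Tree {word :> seq (letter k l); word_reduced : reduced word}.

HB.instance Definition _ k l := [isSub for @word k l].
HB.instance Definition _ k l := [Countable of tree k l by <:].

Section tree_group.
Variables k l : nat.
Implicit Types (a b : letter k l) (u v w : seq (letter k l)) (x y z : tree k l).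

Definition push a w : seq (letter k l) :=
  if w is b :: w' then if b == linv a then w' else a :: w else [:: a].

Definition mulw u v : seq (letter k l) := foldr push v u.

Definition invw u : seq (letter k l) := rev (map (@linv k l) u).

Lemma linvK : involutive (@linv k l).
Proof. by case=> [//|[j []]]. Qed.

Lemma push_reduced a w : reduced w -> reduced (push a w).
Proof.
case: w => [//|b w] /= rw; case: ifPn => [_|ba]; first exact: path_sorted rw.
by rewrite /reduced /= ba.
Qed.

Lemma mulw_reduced u v : reduced v -> reduced (mulw u v).
Proof. by move=> rv; elim: u => //= a u; exact: push_reduced. Qed.

Lemma invw_reduced u : reduced u -> reduced (invw u).
Proof.
move=> ru; rewrite /reduced /invw rev_sorted sorted_map.
move: ru; apply: sub_sorted => a b /=.
apply: contraNN => /eqP ab; by rewrite ab linvK.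
Qed.

Lemma push_linvK a w : reduced w -> push a (push (linv a) w) = w.
Proof.
case: w => [|b w] rw /=; first by rewrite eqxx.
rewrite linvK; case: eqVneq => [ba|_] /=; last by rewrite eqxx.
by subst b; case: w rw => [|c w] //= /andP[/negPf ->].
Qed.

Lemma mulw_push a u v : reduced v -> mulw (push a u) v = push a (mulw u v).
Proof.
move=> rv; case: u => [//|b u] /=; case: eqVneq => [->|//].
by rewrite push_linvK//; exact: mulw_reduced.
Qed.

Lemma mulwA u v w : reduced w -> mulw u (mulw v w) = mulw (mulw u v) w.
Proof. by move=> rw; elim: u => //= a u ->; rewrite mulw_push. Qed.

Lemma push_cons a w : reduced (a :: w) -> push a w = a :: w.
Proof. by case: w => [//|b w] /= /andP[/negPf ->]. Qed.

Lemma mulw_cat u v : reduced (u ++ v) -> mulw u v = u ++ v.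
Proof.
elim: u => //= a u IHu ruv; rewrite IHu ?push_cons//.
exact: path_sorted ruv.
Qed.

Lemma mulw_nil u : reduced u -> mulw u [::] = u.
Proof. by move=> ru; rewrite mulw_cat ?cats0. Qed.

Lemma mulw_invl u v : mulw (invw u) (u ++ v) = v.
Proof.
elim: u => //= a u IHu; rewrite /invw /= rev_cons /mulw foldr_rcons /=.
by rewrite linvK eqxx.
Qed.

Lemma invwK : involutive invw.
Proof.
by move=> u; rewrite /invw map_rev revK mapK//; exact: linvK.
Qed.

Definition tree_mul x y : tree k l := Tree (mulw_reduced x (word_reduced y)).
Definition tree_one : tree k l := @Tree k l [::] isT.
Definition tree_inv x : tree k l := Tree (invw_reduced (word_reduced x)).

Lemma tree_mulA : associative tree_mul.
Proof. by move=> x y z; apply: val_inj; exact: mulwA (word_reduced z). Qed.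

Lemma tree_mul1 : left_id tree_one tree_mul.
Proof. by move=> x; apply: val_inj. Qed.

Lemma tree_mulr1 : right_id tree_one tree_mul.
Proof. by move=> x; apply: val_inj; exact: mulw_nil (word_reduced x). Qed.

Lemma tree_mulV : left_inverse tree_one tree_inv tree_mul.
Proof.
by move=> x; apply: val_inj; rewrite /= -{2}[word x]cats0 mulw_invl.
Qed.

Lemma tree_mulrV : right_inverse tree_one tree_inv tree_mul.
Proof.
move=> x; rewrite -{1}[x](_ : tree_inv (tree_inv x) = x) ?tree_mulV//.
by apply: val_inj; exact: invwK.
Qed.

End tree_group.

HB.instance Definition _ k l := isGroup.Build (tree k l)
  (@tree_mulA k l) (@tree_mul1 k l) (@tree_mulr1 k l)
  (@tree_mulV k l) (@tree_mulrV k l).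
HB.instance Definition _ k l := isPointed.Build (tree k l) 1%g.

Definition gen k l (a : letter k l) : tree k l := @Tree k l [:: a] isT.

(** Graph metric of the Cayley graph with edges [x -- x * gen a], written as a
    word metric; [edistP] says that it is the least number of edges of a walk
    from [x] to [y]. *)
Definition edist k l (x y : tree k l) : nat := size (word (x^-1 * y)%g).

Section tree_metric.
Variables k l : nat.
Implicit Types (a : letter k l) (u v w : seq (letter k l)) (x y z : tree k l).

Lemma size_push a w : (size (push a w) <= (size w).+1)%N.
Proof. by case: w => //= b w; case: ifP => // _; rewrite ltnW// ltnS ltnW. Qed.

Lemma size_mulw u v : (size (mulw u v) <= size u + size v)%N.
Proof. by elim: u => //= a u IHu; exact: leq_trans (size_push _ _) _. Qed.

Lemma prod_gen (s : seq (letter k l)) :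
  word (\prod_(a <- s) gen a)%g = mulw s [::].
Proof.
by elim: s => [|a s IHs]; rewrite ?big_nil// big_cons /= -IHs.
Qed.

Lemma edistP x y n : (edist x y <= n)%N <->
  exists2 s : seq (letter k l),
    (size s <= n)%N & y = (x * \prod_(a <- s) gen a)%g.
Proof.
split=> [xyn|[s sn ->]].
  exists (word (x^-1 * y)%g) => //.
  rewrite (_ : (\prod_(a <- _) gen a)%g = (x^-1 * y)%g) ?mulVKg//.
  by apply: val_inj; exact: etrans (prod_gen _) (mulw_nil (word_reduced _)).
rewrite /edist mulKg prod_gen (leq_trans (size_mulw _ _))// addn0.
exact: leq_trans sn.
Qed.

Lemma edistMl x y z : edist (x * y)%g (x * z)%g = edist y z.
Proof. by rewrite /edist invgM -mulgA mulKg. Qed.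

Lemma edist1x x : edist 1%g x = size (word x).
Proof. by rewrite /edist invg1 mul1g. Qed.

Lemma mulw_size_cat u v :
  size (mulw u v) = (size u + size v)%N -> mulw u v = u ++ v.
Proof.
elim: u => //= a u IHu auv.
have uv : size (mulw u v) = (size u + size v)%N.
  apply/eqP; rewrite eqn_leq size_mulw -ltnS -addSn -auv.
  exact: size_push.
move: auv uv (IHu uv); case: (mulw u v) => [|b w] /=; first by move=> _ _ <-.
case: ifP => [_ wE [wE'] _|_ _ _ ->//]; exfalso.
by move: wE; rewrite addSn -wE' => /eqP; rewrite ltn_eqF// ltnW.
Qed.

Lemma prefix_edist x y :
  prefix (word y) (word x) <->
  (edist 1%g y + edist y x)%N = edist 1%g x.
Proof.
rewrite !edist1x; split=> [/prefixP[s xE]|yx].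
  by rewrite /edist /= xE mulw_invl size_cat.
have xE : word x = mulw y (word (y^-1 * x)%g).
  by rewrite -[in LHS](mulVKg y x).
by rewrite xE mulw_size_cat ?prefix_prefix// -xE -yx.
Qed.

End tree_metric.

Record ray (k l : nat) := Ray {
  ray_fun :> nat -> tree k l;
  ray_geodesic : forall m n, edist (ray_fun m) (ray_fun (m + n)) = n }.

HB.instance Definition _ k l := gen_eqMixin (ray k l).
HB.instance Definition _ k l := gen_choiceMixin (ray k l).

Definition ray_equiv k l (r s : ray k l) : bool :=
  `[< finite_set ((range r `\` range s) `|` (range s `\` range r)) >].

Lemma ray_equiv_refl k l : reflexive (@ray_equiv k l).
Proof. by move=> r; apply/asboolP; rewrite setDv setU0. Qed.

Lemma ray_equiv_sym k l : symmetric (@ray_equiv k l).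
Proof. by move=> r s; rewrite /ray_equiv setUC. Qed.

Lemma ray_equiv_trans k l : transitive (@ray_equiv k l).
Proof.
move=> s r t /asboolP rs /asboolP st; apply/asboolP.
have : finite_set (((range r `\` range s) `|` (range s `\` range r)) `|`
  ((range s `\` range t) `|` (range t `\` range s))) by rewrite finite_setU.
apply: sub_finite_set => x /= [] [rx nx].
  by case: (pselect (range s x)); [right; left|left; left].
by case: (pselect (range s x)); [left; right|right; right].
Qed.

Canonical ray_equivR k l := EquivRel (@ray_equiv k l)
  (@ray_equiv_refl k l) (@ray_equiv_sym k l) (@ray_equiv_trans k l).

Definition tree_end (k l : nat) : Type := {eq_quot (@ray_equiv k l)}%qT.
HB.instance Definition _ k l := Choice.on (tree_end k l).
Definition end_of k l (r : ray k l) : tree_end k l :=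
  \pi_({eq_quot (@ray_equiv k l)})%qT r.

(** The compactified tree: vertices and ends. *)
Inductive hat_tree (k l : nat) : Type :=
  | Vertex of tree k l
  | End of tree_end k l.

HB.instance Definition _ k l := gen_eqMixin (hat_tree k l).
HB.instance Definition _ k l := gen_choiceMixin (hat_tree k l).
HB.instance Definition _ k l := isPointed.Build (hat_tree k l) (Vertex 1%g).

(** Vertex set of the geodesic from the root to a point of [hat_tree]. *)
Definition geodesic k l (w : hat_tree k l) : set (tree k l) :=
  match w with
  | Vertex x => [set y | (edist 1%g y + edist y x)%N = edist 1%g x]
  | End e => [set y | exists r : ray k l,
                        [/\ end_of r = e, r 0%N = 1%g & range r y]]
  end.

(** [(w|z)]: the common initial part of the two geodesics has length the
    distance from the root of their farthest common vertex.  The common part is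
    finite as soon as [w != z]. *)
Definition confluent k l (w z : hat_tree k l) : nat :=
  (\max_(y <- fset_set (geodesic w `&` geodesic z)) edist 1%g y)%N.

(** The number [q], all vertices having degree [q + 1 = k + 2 l]. *)
Definition branching (k l : nat) : nat := (k + l.*2).-1.

Definition rho k l (w z : hat_tree k l) : rat :=
  if w == z then 0 else (branching k l)%:R ^- confluent w z.

Section rho_metric.
Variables k l : nat.
Implicit Types (r s : ray k l) (x y : tree k l) (w z u : hat_tree k l).

Lemma ray_size r n : r 0%N = 1%g -> size (word (r n)) = n.
Proof. by move=> r0; rewrite -edist1x -r0 -[n in r n]add0n ray_geodesic. Qed.

Lemma ray_prefix r m n : r 0%N = 1%g ->
  (m <= n)%N -> prefix (word (r m)) (word (r n)).
Proof.
move=> r0 mn; apply/prefix_edist; rewrite !edist1x !ray_size//.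
by rewrite -{1}(subnKC mn) ray_geodesic subnKC.
Qed.

Lemma ray_take r m n : r 0%N = 1%g ->
  (m <= n)%N -> word (r m) = take m (word (r n)).
Proof.
move=> r0 mn; have /prefixP[t ->] := ray_prefix r0 mn.
by rewrite take_size_cat// ray_size.
Qed.

Lemma ray_inj r : injective r.
Proof.
move=> m n; wlog mn : m n / (m <= n)%N => [H|].
  by case: (leqP m n) => [|/ltnW] mn e; [|symmetry]; apply: H => //.
rewrite -(subnKC mn) => e.
have := ray_geodesic r m (n - m); rewrite -e /edist mulVg /= => <-.
by rewrite addn0.
Qed.

Lemma ray_eq r s : (forall n, r n = s n) -> r = s.
Proof.
case: r s => [f pf] [g pg] /= fg.
have {}fg : f = g by exact/funext.
by subst g; congr Ray; exact: Prop_irrelevance.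
Qed.

Lemma rays_from_root r s : r 0%N = 1%g -> s 0%N = 1%g ->
  (forall n, exists2 m, (n <= m)%N & r m = s m) -> r = s.
Proof.
move=> r0 s0 rs; apply: ray_eq => n; apply: val_inj => /=.
have [m nm e] := rs n.
by rewrite (ray_take r0 nm) (ray_take s0 nm) e.
Qed.

Lemma infinite_geq n : ~ finite_set [set m : nat | (n <= m)%N].
Proof.
move=> fn; apply: infinite_nat.
rewrite (_ : setT = [set m | (n <= m)%N] `|` `I_n) ?finite_setU//.
apply/seteqP; split => // m _ /=; case: (leqP n m); [by left|by right].
Qed.

Lemma ray_equiv_root r s : r 0%N = 1%g -> s 0%N = 1%g ->
  end_of r = end_of s -> r = s.
Proof.
move=> r0 s0 /eqmodP /asboolP rs; apply: rays_from_root => // n.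
apply: contrapT => H; apply: (@infinite_geq n).
have : finite_set ((fun x => size (word x)) @` (range r `\` range s)).
  by apply: finite_image; apply: sub_finite_set rs => x; left.
apply: sub_finite_set => m /= nm; exists (r m); last exact: ray_size.
split; first by exists m.
move=> [m' _ e]; apply: H; exists m => //.
by rewrite -[m in s m](ray_size m r0) -e ray_size.
Qed.

Lemma geodesic_prefix w x y :
  prefix (word y) (word x) -> geodesic w x -> geodesic w y.
Proof.
case: w => [v|e] yx /=.
  move=> /prefix_edist xv; apply/prefix_edist.
  exact: prefix_trans xv.
move=> [r [re r0 [n _ rnx]]]; exists r; split => //.
exists (size (word y)) => //; apply: val_inj => /=.
have yn : (size (word y) <= n)%N.
  by rewrite -(ray_size n r0) rnx size_prefix.
rewrite (ray_take r0 yn) rnx.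
by case/prefixP: yx => t ->; rewrite take_size_cat.
Qed.

Lemma geodesic_total w x y : geodesic w x -> geodesic w y ->
  (size (word y) <= size (word x))%N -> prefix (word y) (word x).
Proof.
case: w => [v|e] /=.
  move=> /prefix_edist /prefixP[s vs] /prefix_edist /prefixP[t vt] yx.
  have -> : word y = take (size (word y)) (word x).
    have := congr1 (take (size (word y))) vs.
    rewrite {1}vt take_size_cat// takel_cat//.
  exact: prefix_take.
move=> [r [re r0 [m _ rx]]] [s [se s0 [n _ sy]]].
have rs : r = s by apply: ray_equiv_root => //; rewrite se.
subst s; rewrite -rx -sy !ray_size// => nm; exact: ray_prefix.
Qed.

Lemma geodesic_size_inj w x y : geodesic w x -> geodesic w y ->
  size (word y) = size (word x) -> x = y.
Proof.
move=> wx wy yx; apply: val_inj => /=; apply/eqP; rewrite eq_sym.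
have := geodesic_total wx wy; rewrite yx leqnn => /(_ isT) /prefixP[t xt].
move: (congr1 size xt); rewrite size_cat yx => /eqP.
by rewrite -{1}[size _]addn0 eqn_add2l eq_sym size_eq0 xt => /eqP ->; rewrite cats0.
Qed.

Lemma finite_geodesic w (A : set (tree k l)) n : A `<=` geodesic w ->
  (forall x, A x -> (size (word x) <= n)%N) -> finite_set A.
Proof.
move=> Aw An.
have inj : {in A &, injective (fun x : tree k l => size (word x))}.
  move=> x y /set_mem/Aw wx /set_mem/Aw wy e.
  by apply: geodesic_size_inj wx wy _; exact: esym e.
rewrite -(eq_finite_set (inj_card_eq inj)).
apply: (@sub_finite_set _ _ `I_n.+1) => // _ [x Ax <-] /=.
by rewrite ltnS; exact: An.
Qed.

Lemma finite_common w z : w != z -> finite_set (geodesic w `&` geodesic z).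
Proof.
have vertex x A : A `<=` geodesic (Vertex x) -> finite_set A.
  move=> Ax; apply: (finite_geodesic (n := size (word x)) Ax) => y /Ax /=.
  by move/prefix_edist/size_prefix.
case: w => [x _|e]; first by apply: vertex; exact: subIsetl.
case: z => [x _|e']; first by apply: vertex; exact: subIsetr.
move=> ee'; apply: contrapT => inf; case/negP: ee'; apply/eqP; congr End.
have {}inf n : exists2 y, (n <= size (word y))%N &
    (geodesic (End e) `&` geodesic (End e')) y.
  apply: contrapT => H; apply: inf; apply: (@finite_geodesic (End e) _ n).
    exact: subIsetl.
  move=> x ex; rewrite leqNgt; apply/negP => nx; apply: H.
  by exists x => //; exact: ltnW.
have [_ _ [[r [rE r0 _]] [s [sE s0 _]]]] := inf 0%N.
rewrite -rE -sE; suff -> : r = s by []; apply: rays_from_root => // n.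
have [y ny [[r' [re r'0 [m _ rm]]] [s' [se s'0 [m' _ sm]]]]] := inf n.
have rr' := ray_equiv_root r'0 r0 (etrans re (esym rE)).
have ss' := ray_equiv_root s'0 s0 (etrans se (esym sE)).
subst r' s'; exists m; first by rewrite -(ray_size m r0) rm.
by rewrite -[m in s m](ray_size m r0) rm -sm ray_size.
Qed.

Lemma geodesic_leq w z y : w != z -> geodesic w y -> geodesic z y ->
  (size (word y) <= confluent w z)%N.
Proof.
move=> wz wy zy; rewrite -edist1x /confluent.
apply: (@leq_bigmax_seq _ _ _ (fun y => edist 1%g y)) => //.
by rewrite in_fset_set ?mem_set//; exact: finite_common.
Qed.

Lemma confluent_attained w z : w != z -> confluent w z = 0%N \/
  exists y, [/\ geodesic w y, geodesic z y & size (word y) = confluent w z].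
Proof.
move=> /finite_common fin; rewrite /confluent.
have : forall y, y \in (fset_set (geodesic w `&` geodesic z) : seq _) ->
    geodesic w y /\ geodesic z y.
  by move=> y; rewrite in_fset_set// => /set_mem.
move: (fset_set _) => F; elim: (F : seq _) => [|a A IHA] wz.
  by left; rewrite big_nil.
rewrite big_cons /=; have [wa za] := wz a (mem_head _ _).
case: (leqP (\max_(y <- A) edist 1%g y)%N (edist 1%g a)) => [le|/ltnW ge].
  by right; exists a; rewrite edist1x.
by apply: IHA => y yA; apply: wz; rewrite inE yA orbT.
Qed.

Lemma confluentC w z : confluent w z = confluent z w.
Proof. by rewrite /confluent setIC. Qed.

Lemma confluent_ultra w z u : w != z -> z != u -> w != u ->
  (minn (confluent w z) (confluent z u) <= confluent w u)%N.
Proof.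
move=> wz zu wu.
have [->|[x [wx zx xE]]] := confluent_attained wz; first by rewrite min0n.
have [->|[y [zy uy yE]]] := confluent_attained zu; first by rewrite minn0.
rewrite -xE -yE; case: (leqP (size (word x)) (size (word y))) => [|/ltnW] xy.
  apply: geodesic_leq => //; apply: geodesic_prefix uy.
  exact: geodesic_total zy zx xy.
apply: geodesic_leq => //; apply: geodesic_prefix wx.
exact: geodesic_total zx zy xy.
Qed.

Lemma branching0 w z : branching k l = 0%N -> w != z -> confluent w z = 0%N.
Proof.
move=> b0 wz; have [//|[y [wy zy <-]]] := confluent_attained wz.
have letters (a b : letter k l) : a = b.
  have : (#|{: letter k l}| <= 1)%N.
    rewrite card_sum card_prod !card_ord card_bool muln2.
    by move: b0; rewrite /branching; case: (k + l.*2)%N => [|[]].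
  by move=> /fintype_le1P /(_ b a).
have short (x : tree k l) : (size (word x) <= 1)%N.
  case: x => [[|a [|b t]]] //= /andP[/negP ba _]; exfalso; apply: ba.
  exact/eqP/letters.
apply/eqP; rewrite eqn_leq leq0n andbT leqNgt; apply/negP => y0.
have vertex v : geodesic v y -> v = Vertex y.
  case: v => [v /prefix_edist yv|e [r [_ r0 _]]].
    congr Vertex; apply: val_inj => /=; case/prefixP: yv => t vt.
    have := short v; rewrite vt size_cat => yt1.
    suff : size t = 0%N by move=> /size0nil ->; rewrite cats0.
    by apply/eqP; rewrite -leqn0 -(leq_add2l (size (word y))) addn0 (leq_trans yt1).
  by have := short (r 2%N); rewrite ray_size.
by case/negP: wz; rewrite (vertex _ wy) (vertex _ zy).
Qed.

Lemma rho_ge0 w z : 0 <= rho w z.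
Proof. by rewrite /rho; case: ifP => // _; rewrite invr_ge0 exprn_ge0. Qed.

Lemma rhoxx w : rho w w = 0.
Proof. by rewrite /rho eqxx. Qed.

Lemma rho_eq0 w z : rho w z = 0 -> w = z.
Proof.
rewrite /rho; case: eqVneq => // wz /eqP; rewrite invr_eq0 expf_eq0.
by rewrite pnatr_eq0 => /andP[c0 /eqP b0]; rewrite branching0 in c0.
Qed.

Lemma rhoC w z : rho w z = rho z w.
Proof. by rewrite /rho eq_sym confluentC. Qed.

Lemma rho_ultra z w u : rho w u <= Num.max (rho w z) (rho z u).
Proof.
have [->|wu] := eqVneq w u; first by rewrite rhoxx le_max !rho_ge0.
have [->|wz] := eqVneq w z; first by rewrite le_max lexx orbT.
have [<-|zu] := eqVneq z u; first by rewrite le_max lexx.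
rewrite /rho (negPf wu) (negPf wz) (negPf zu).
have [b0|b0] := eqVneq (branching k l) 0%N.
  by rewrite !branching0// le_max lexx.
have mono m n : (m <= n)%N ->
    (branching k l)%:R ^- n <= (branching k l)%:R ^- m :> rat.
  move=> mn; rewrite lef_pV2 ?posrE ?exprn_gt0 ?ltr0n ?lt0n//.
  by rewrite ler_weXn2l// ler1n lt0n.
have := confluent_ultra wz zu wu; rewrite geq_min le_max.
by move=> /orP[] /mono ->; rewrite ?orbT.
Qed.

Lemma rho_triangle z w u : rho w u <= rho w z + rho z u.
Proof.
rewrite (le_trans (rho_ultra z w u))// ge_max.
by rewrite lerDl lerDr !rho_ge0.
Qed.

End rho_metric.

(** [rho] is rational-valued; only the topology it induces is used. *)
HB.instance Definition _ k l := isMetric.Build rat (hat_tree k l)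
  (@rhoxx k l) (@rho_eq0 k l) (@rhoC k l) (@rho_triangle k l).

(** Finitely supported lamp configurations.  ['Z_r] is Z/rZ for [1 < r]. *)
Definition conf (r k l : nat) : Type := {fsfun tree k l -> 'Z_r with 0%R}.
HB.instance Definition _ r k l := Countable.on (conf r k l).

Section configurations.
Variables r k l : nat.
Implicit Types (e : conf r k l) (x y : tree k l).

Definition conf0 : conf r k l := [fsfun].

Definition conf_add e e' : conf r k l :=
  [fsfun y in (finsupp e `|` finsupp e')%fset => e y + e' y].

Definition conf_opp e : conf r k l := [fsfun y in finsupp e => - e y].

(** [T_x] on finitely supported configurations. *)
Definition conf_shift x e : conf r k l :=
  [fsfun y in [fset (x * z)%g | z in finsupp e]%fset => e (x^-1 * y)%g].

Lemma conf0E y : conf0 y = 0.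
Proof. by rewrite fsfunE. Qed.

Lemma conf_addE e e' y : conf_add e e' y = e y + e' y.
Proof.
rewrite fsfunE in_fsetU; case: finsuppP => //= ye.
by case: finsuppP => // ye'; rewrite addr0.
Qed.

Lemma conf_oppE e y : conf_opp e y = - e y.
Proof. by rewrite fsfunE; case: finsuppP => // _; rewrite oppr0. Qed.

Lemma conf_shiftE x e y : conf_shift x e y = e (x^-1 * y)%g.
Proof.
rewrite fsfunE; case: ifPn => // xy; rewrite fsfun_dflt//.
apply: contra xy => xy; apply/imfsetP; exists (x^-1 * y)%g => //=.
by rewrite mulVKg.
Qed.

End configurations.

(** The wreath product: lamp configuration and position of the lamplighter. *)
Record lamplighter (r k l : nat) :=
  Lamplighter { lamps : conf r k l; pos : tree k l }.

Section lamplighter_group.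
Variables r k l : nat.
Implicit Types g h : lamplighter r k l.

Definition lamplighter_code g := (lamps g, pos g).
Definition lamplighter_decode (p : conf r k l * tree k l) :=
  Lamplighter p.1 p.2.

Lemma lamplighter_codeK : cancel lamplighter_code lamplighter_decode.
Proof. by case. Qed.

End lamplighter_group.

HB.instance Definition _ r k l :=
  Countable.copy (lamplighter r k l) (can_type (@lamplighter_codeK r k l)).

Section lamplighter_group.
Variables r k l : nat.
Implicit Types g h : lamplighter r k l.

Definition lamplighter_mul g h : lamplighter r k l :=
  Lamplighter (conf_add (lamps g) (conf_shift (pos g) (lamps h)))
              (pos g * pos h)%g.

Definition lamplighter_one : lamplighter r k l :=
  Lamplighter (conf0 r k l) 1%g.

Definition lamplighter_inv g : lamplighter r k l :=
  Lamplighter (conf_opp (conf_shift (pos g)^-1%g (lamps g))) (pos g)^-1%g.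

Lemma lamplighter_eq g h :
  lamps g =1 lamps h -> pos g = pos h -> g = h.
Proof. by case: g h => [e x] [e' x'] /= /fsfunP -> ->. Qed.

Lemma lamplighter_mulA : associative lamplighter_mul.
Proof.
move=> g h i; apply: lamplighter_eq => [y|] /=; last exact: mulgA.
by rewrite !(conf_addE, conf_shiftE) addrA invgM mulgA.
Qed.

Lemma lamplighter_mul1 : left_id lamplighter_one lamplighter_mul.
Proof.
move=> g; apply: lamplighter_eq => [y|] /=; last exact: mul1g.
by rewrite conf_addE conf_shiftE conf0E add0r invg1 mul1g.
Qed.

Lemma lamplighter_mulr1 : right_id lamplighter_one lamplighter_mul.
Proof.
move=> g; apply: lamplighter_eq => [y|] /=; last exact: mulg1.
by rewrite conf_addE conf_shiftE conf0E addr0.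
Qed.

Lemma lamplighter_mulV :
  left_inverse lamplighter_one lamplighter_inv lamplighter_mul.
Proof.
move=> g; apply: lamplighter_eq => [y|] /=; last exact: mulVg.
by rewrite conf_addE conf_oppE !conf_shiftE conf0E addNr.
Qed.

Lemma lamplighter_mulrV :
  right_inverse lamplighter_one lamplighter_inv lamplighter_mul.
Proof.
move=> g; apply: lamplighter_eq => [y|] /=; last exact: mulgV.
by rewrite conf_addE !(conf_shiftE, conf_oppE) conf0E invgK mulVKg subrr.
Qed.

End lamplighter_group.

HB.instance Definition _ r k l := isGroup.Build (lamplighter r k l)
  (@lamplighter_mulA r k l) (@lamplighter_mul1 r k l) (@lamplighter_mulr1 r k l)
  (@lamplighter_mulV r k l) (@lamplighter_mulrV r k l).
HB.instance Definition _ r k l := isPointed.Build (lamplighter r k l) 1%g.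
HB.instance Definition _ r k l := @isMeasurable.Build default_measure_display
  (lamplighter r k l) discrete_measurable discrete_measurable0
  discrete_measurableC discrete_measurableU.

Definition lamp_state (r : nat) : Type := discrete_topology 'Z_r.
HB.instance Definition _ r := DiscreteUniform.on (lamp_state r).
HB.instance Definition _ r := isPointed.Build (lamp_state r) (0 : 'Z_r).

Definition hat_conf (r k l : nat) : Type := {ptws tree k l -> lamp_state r}.
HB.instance Definition _ r k l := Uniform.on (hat_conf r k l).
HB.instance Definition _ r k l := Pointed.on (hat_conf r k l).

(** Compactification of the lamplighter group. *)
Definition compactification (r k l : nat) : Type :=
  (hat_conf r k l * hat_tree k l)%type.
HB.instance Definition _ r k l := Pointed.on (compactification r k l).
HB.instance Definition _ r k l := Uniform.on (compactification r k l).

Definition embed r k l (g : lamplighter r k l) : compactification r k l :=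
  (lamps g : tree k l -> 'Z_r, Vertex (pos g)).

(** Functions on the boundary are handled as functions on the compactification
    whose values off this subset are irrelevant. *)
Definition boundary (r k l : nat) : set (compactification r k l) :=
  [set b | exists e, b.2 = End e].

Definition borel (r k l : nat) :=
  g_sigma_algebraType (@open (compactification r k l)).

Section action.
Variables r k l : nat.

Lemma ray_shift_geodesic (x : tree k l) (s : ray k l) m n :
  edist (x * s m)%g (x * s (m + n))%g = n.
Proof. by rewrite edistMl ray_geodesic. Qed.

Definition ray_shift (x : tree k l) (s : ray k l) : ray k l :=
  Ray (ray_shift_geodesic x s).

Definition tree_act (x : tree k l) (w : hat_tree k l) : hat_tree k l :=
  match w with
  | Vertex y => Vertex (x * y)%g
  | End e => End (end_of (ray_shift x (repr e)))
  end.

Definition act (g : lamplighter r k l) (b : compactification r k l) :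
    compactification r k l :=
  ((fun y => lamps g y + b.1 ((pos g)^-1 * y)%g) : tree k l -> 'Z_r,
   tree_act (pos g) b.2).

End action.

Section random_walk.
Variables (R : realType) (r k l : nat).
Local Notation Gamma := (lamplighter r k l).
Implicit Type mu : probability Gamma R.

(** [supp mu] generates the group as a semigroup. *)
Definition irreducible mu : Prop := forall g : Gamma,
  exists s : seq Gamma,
    [/\ s != [::], (forall h, h \in s -> (0 < mu [set h])%E)
      & g = (\prod_(h <- s) h)%g].

(** [R(mu)], with value -oo if the lamps are never switched. *)
Definition lamp_range mu : \bar R :=
  ereal_sup [set e | exists (g : Gamma) (y : tree k l),
    [/\ (0 < mu [set g])%E, y \in finsupp (lamps g)
      & e = (minn (edist y 1%g) (edist y (pos g)))%:R%:E]].

Definition transition mu (g g' : Gamma) : R := fine (mu [set (g^-1 * g')%g]).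

(** The series has terms of both signs and an unordered countable index set:
    the equation is understood with absolute convergence. *)
Definition harmonic_fun mu (h : Gamma -> R) : Prop := forall g : Gamma,
  let u := fun g' => (transition mu g g' * h g')%:E in
  summable [set: Gamma] u /\
  (h g)%:E = (\esum_(g' in [set: Gamma]) u^\+ g' -
              \esum_(g' in [set: Gamma]) u^\- g')%E.

(** Mutual independence of a sequence of group-valued random variables; every
    subset of the (discrete) group is an event. *)
Definition independent d (Omega : measurableType d) (P : probability Omega R)
    (X : nat -> {RV P >-> Gamma}) : Prop :=
  forall (J : {fset nat}) (A : nat -> set Gamma),
    P (\bigcap_(n in [set` J]) X n @^-1` A n) =
    (\prod_(n <- J) P (X n @^-1` A n))%E.

(** The right random walk started at [g0]; [X n] is the increment number
    [n + 1]. *)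
Definition walk (Omega : Type) (g0 : Gamma) (X : nat -> Omega -> Gamma)
    (n : nat) (omega : Omega) : Gamma :=
  (g0 * \prod_(0 <= i < n) X i omega)%g.

(** [nu_g U = nu (g^-1 U)]. *)
Definition translate (nu : set (borel r k l) -> \bar R) (g : Gamma) :
    set (borel r k l) -> \bar R :=
  fun U => nu (act g^-1%g @` U).

(** The trace on the group of the neighbourhoods of a boundary point. *)
Definition group_nbhs (b : compactification r k l) : set_system Gamma :=
  filter_from (nbhs b) (fun U => @embed r k l @^-1` U).

End random_walk.

(* Main.v *)
(** The limit [Zoo] satisfies [Zoo = X_0 Zoo'], where [Zoo'] is the limit of the
    walk with increments [X_1, X_2, ...]; it is independent of [X_0] and has the
    law of [Zoo].  This gives harmonicity of [g |-> E f(g Zoo)].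

    The end [W] of [Zoo] has no atom: an atom of maximal mass would, by
    stationarity and irreducibility, have the same mass along its whole orbit,
    which is infinite.  By Koenig's lemma the probability that the walk ever
    enters the branch of [v] therefore tends to 0 as [|v|] grows, uniformly in
    [v].  When [g = (eta, x)] tends to [(zeta, e)], the boundary point [g Zoo]
    is far from [(zeta, e)] only if [W] lies in the branch of a long initial piece
    of [x^-1], or if [Zoo] has a lamp on at [x^-1 y] for one of finitely many
    vertices [y]; by bounded range the latter forces the walk into the branch of
    a vertex close to [x^-1 y].  So [g Zoo] tends to [(zeta, e)] in probability,
    and [f] is bounded because the boundary is compact. *)

From mathcomp Require Import all_boot all_order all_algebra.
From mathcomp Require Import finmap generic_quotient ring zify.
From mathcomp Require Import all_classical all_reals all_analysis
  measurable_realfun.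
Require Import Defs.

Set Implicit Arguments.
Unset Strict Implicit.
Unset Printing Implicit Defensive.

Import Order.TTheory GRing.Theory Num.Theory numFieldNormedType.Exports.

Local Open Scope classical_set_scope.
Local Open Scope ring_scope.

(** * Reduced words, rays and ends *)

(** The limit [Zoo'] of the shifted walk is never built as a random variable. Its law is reached
    through finite times: independence relates [X 0 = x] and position [n.+1] of the walk to [x]
    times position [n], and for a clopen set both probabilities pass to the limit, because
    membership in such a set is eventually constant along a convergent sequence. The
    compactification has a countable base of clopen sets, so these determine finite Borel measures.

    Absence of atoms alone concerns only the limit end. A lamp left on at a vertex says nothing
    about that end, only that the walk came near the vertex at some time. The estimates are
    therefore made for the larger events [hit v]; along a ray they decrease to an event which, up to
    a null set, forces the limit to be the end of that ray.

    Boundary values do not yet give the continuous extension: group points are not isolated in the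
    compactification, since a neighbourhood controls only finitely many lamps. Continuity there is a
    separate dominated convergence argument ([poisson_lamps]). *)

Section tree_words.
Variables k l : nat.
Implicit Types (a : letter k l) (u v w : seq (letter k l)) (x y z : tree k l).

Lemma size_push_ge a w : (size w <= (size (push a w)).+1)%N.
Proof. by case: w => //= b w; case: ifP => //= _; rewrite ltnW. Qed.

Lemma size_mulw_ge u w : (size w <= size u + size (mulw u w))%N.
Proof.
elim: u => //= a u /leq_trans; apply.
by rewrite addSnnS leq_add2l; exact: size_push_ge.
Qed.

Lemma prefix_push a u w : (0 < size u)%N -> prefix u w ->
  prefix (push a u) (push a w).
Proof.
case: u w => [//|b u] [|c w] //= _ /andP[/eqP <- uw].
by case: ifP => // _ /=; rewrite !eqxx.
Qed.

(* At most [size x] letters cancel in the product [x w], so that the prefixes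
   of [w] which are at least that long are moved to prefixes. *)
Lemma prefix_mulw v u w : (size v <= size u)%N -> prefix u w ->
  prefix (mulw v u) (mulw v w).
Proof.
elim: v => //= a v IHv vu uw; apply: prefix_push; last exact: IHv (ltnW vu) uw.
have := leq_trans vu (size_mulw_ge v u).
by rewrite -addn1 leq_add2l.
Qed.

Lemma prefix_mul x y z : (size x <= size y)%N -> prefix (word y) (word z) ->
  prefix (word (x * y)%g) (word (x * z)%g).
Proof. exact: prefix_mulw. Qed.

Lemma size_mul_ge x y : (size (word y) <= size (word x) + size (word (x *
  y)%g))%N.
Proof. exact: size_mulw_ge. Qed.

Lemma size_invg x : size (word x^-1%g) = size (word x).
Proof. by rewrite /= /invw size_rev size_map. Qed.

Lemma edistC x y : edist x y = edist y x.
Proof. by rewrite /edist -size_invg invgM invgK. Qed.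

Lemma take_reduced n w : reduced w -> reduced (take n w).
Proof. exact: take_sorted. Qed.

Definition tree_take n x : tree k l := Tree (take_reduced n (word_reduced x)).

Lemma size_tree_take n x : (n <= size x)%N -> size (tree_take n x) = n.
Proof. exact: size_takel. Qed.

Lemma prefix_tree_take n x : prefix (word (tree_take n x)) (word x).
Proof. exact: prefix_take. Qed.

Lemma prefix_size_eq u v w : prefix u w -> prefix v w -> size u = size v ->
  u = v.
Proof.
move=> /prefixP[s wE] /prefixP[t] wE' uv.
have := congr1 (take (size u)) wE'; rewrite {1}wE take_size_cat// => ->.
by rewrite uv take_size_cat.
Qed.

Lemma prefix_comparable u v w : prefix u w -> prefix v w ->
  (size u <= size v)%N -> prefix u v.
Proof.
move=> uw vw uv; suff -> : u = take (size u) v by exact: prefix_take.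
apply: (prefix_size_eq uw); last by rewrite size_takel.
exact: prefix_trans (prefix_take _ _) vw.
Qed.

End tree_words.

(** * Rays from the root as representatives of ends; Koenig's lemma *)

Section rays.
Variables k l : nat.
Implicit Types (a : letter k l) (x y z v : tree k l) (r s t : ray k l)
  (e : tree_end k l) (w : hat_tree k l).

(** A working form of equality of ends ([tail_equal_end], [end_of_tail_equal]): unlike a finite
    symmetric difference of ranges, it is visibly preserved by translations. *)
Definition tail_equal r s := exists N M, forall n, r (n + N)%N = s (n + M)%N.

Lemma tail_equal_sym r s : tail_equal r s -> tail_equal s r.
Proof. by move=> [N [M rs]]; exists M, N => n. Qed.

Lemma tail_equal_trans s r t : tail_equal r s -> tail_equal s t ->
  tail_equal r t.
Proof.
move=> [N [M rs]] [N' [M' st]]; exists (N + N')%N, (M + M')%N => n.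
by rewrite (addnC N) addnA rs addnAC st -addnA.
Qed.

Lemma tail_equal_range_finite r s : tail_equal r s ->
  finite_set (range r `\` range s).
Proof.
move=> [N [M rs]].
apply: (@sub_finite_set _ _ (r @` `I_N)); last exact: finite_image.
move=> _ [[n _ <-] sn]; exists n => //=; rewrite ltnNge; apply/negP => Nn.
by apply: sn; exists (n - N + M)%N => //; rewrite -rs subnK.
Qed.

Lemma tail_equal_end r s : tail_equal r s -> end_of r = end_of s.
Proof.
move=> rs; apply/eqmodP/asboolP; rewrite finite_setU.
by split; apply: tail_equal_range_finite => //; exact: tail_equal_sym.
Qed.

Lemma ray_shift_tail_equal x r s : tail_equal r s ->
  tail_equal (ray_shift x r) (ray_shift x s).
Proof. by move=> [N [M rs]]; exists N, M => n /=; rewrite rs. Qed.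

(** If [a] cancels the first letter of [t], the translate passes through the root at time 1 and its
    starting vertex is dropped. Otherwise nothing cancels and the root can be put in front of it. *)
Lemma ray_shift_gen a t : t 0%N = 1%g ->
  exists2 r : ray k l, r 0%N = 1%g & tail_equal (ray_shift (gen a) t) r.
Proof.
move=> t0; have t1 := ray_size 1 t0.
case tb : (word (t 1%N)) t1 => [//|b [|//]] _.
have tE n : exists u, word (t n.+1) = b :: u.
  have := ray_prefix t0 (ltn0Sn n); rewrite tb => /prefixP[u ->].
  by exists u.
have [ba|nba] := eqVneq b (linv a).
  have geo m n : edist (t m.+1) (t (m + n).+1) = n.
    by rewrite -addSn ray_geodesic.
  exists (ray_shift (gen a) (Ray geo)); last by exists 1%N, 0%N => n;
    rewrite /= addn0 addn1.
  by apply: val_inj; rewrite /= tb /= ba eqxx.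
have szE n : size (word (gen a * t n)%g) = n.+1.
  have := ray_size n t0; rewrite /=.
  case: n => [|n]; first by move=> /size0nil ->.
  by have [u ->] := tE n; rewrite /= (negPf nba) /= => ->.
pose f n := if n is m.+1 then (gen a * t m)%g else 1%g.
have geo m n : edist (f m) (f (m + n)%N) = n.
  case: m => [|m]; last by rewrite edistMl ray_geodesic.
  by rewrite edist1x; case: n => //= n; exact: szE.
by exists (Ray geo) => //; exists 0%N, 1%N => n; rewrite addn0 addn1.
Qed.

Lemma ray_shift1 r : ray_shift 1%g r = r.
Proof. by apply: ray_eq => n /=; rewrite mul1g. Qed.

Lemma ray_shiftM x y r : ray_shift (x * y)%g r = ray_shift x (ray_shift y r).
Proof. by apply: ray_eq => n /=; rewrite mulgA. Qed.

Lemma ray_shift_root x t : t 0%N = 1%g ->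
  exists2 r : ray k l, r 0%N = 1%g & tail_equal (ray_shift x t) r.
Proof.
move=> t0; case: x => w; elim: w => [|a w IHw] rw.
  exists t => //; rewrite (_ : Tree rw = 1%g) ?ray_shift1; last exact: val_inj.
  by exists 0%N, 0%N.
have [s s0 ws] := IHw (path_sorted rw).
rewrite (_ : Tree rw = gen a * Tree (path_sorted rw))%g; last first.
  by apply: val_inj => /=; rewrite push_cons.
rewrite ray_shiftM; have [r r0 ar] := ray_shift_gen a s0.
by exists r => //; exact: tail_equal_trans (ray_shift_tail_equal _ ws) ar.
Qed.

(* A ray which starts at [x] is the image under [x] of a ray from the root. *)
Lemma root_tail r : exists2 s : ray k l, s 0%N = 1%g & tail_equal r s.
Proof.
have r0 : ray_shift (r 0%N)^-1%g r 0%N = 1%g by rewrite /= mulVg.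
have [s s0] := ray_shift_root (r 0%N) r0.
by rewrite -ray_shiftM mulgV ray_shift1; exists s.
Qed.

Lemma root_ray e : exists2 r : ray k l, r 0%N = 1%g & e = end_of r.
Proof.
have [r r0 er] := root_tail (repr e); exists r => //.
by rewrite -(tail_equal_end er) /end_of reprK.
Qed.

(** Both rays have tails in common with rays from the root, and two rays from the root with the same
    end are equal. *)
Lemma end_of_tail_equal r s : end_of r = end_of s -> tail_equal r s.
Proof.
move=> rs; have [r' r'0 rr'] := root_tail r; have [s' s'0 ss'] := root_tail s.
have e : r' = s'.
  apply: ray_equiv_root => //.
  by rewrite -(tail_equal_end rr') rs (tail_equal_end ss').
by apply: tail_equal_trans rr' _; rewrite e; exact: tail_equal_sym.
Qed.

Lemma geodesic_root r x : r 0%N = 1%g ->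
  geodesic (End (end_of r)) x <-> r (size (word x)) = x.
Proof.
move=> r0; split=> [[s [sr s0 [n _ <-]]]|<-].
  by rewrite ray_size//; have -> : s = r by exact: ray_equiv_root.
by exists r; split => //; exists (size (word x)).
Qed.

(** A criterion which does not require [r] to start at the root, as is needed for translated
    rays. *)
Lemma geodesic_end_of r x : geodesic (End (end_of r)) x <->
  exists N, forall n, (N <= n)%N -> prefix (word x) (word (r n)).
Proof.
have [s s0 rs] := root_tail r; rewrite (tail_equal_end rs).
have [N [M {}rs]] := rs; split=> [/(geodesic_root _ s0) xs|[N' rx]].
  exists (N + size (word x))%N => n nx; rewrite -xs.
  have Nn : (N <= n)%N by rewrite (leq_trans _ nx)// leq_addr.
  rewrite -(subnK Nn) rs; apply: ray_prefix => //.
  by rewrite (@leq_trans (n - N)%N) ?leq_addr// leq_subRL.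
apply/(geodesic_root _ s0).
have : prefix (word x) (word (s (N' + size (word x) + M)%N)).
  by rewrite -rs rx// -addnA leq_addr.
move=> /prefixP[u sE]; apply: val_inj => /=.
have le : (size (word x) <= N' + size (word x) + M)%N.
  by rewrite (leq_trans (leq_addl N' _))// leq_addr.
by rewrite (ray_take s0 le) sE take_size_cat.
Qed.

Lemma tree_act_end_of x r :
  tree_act x (End (end_of r)) = End (end_of (ray_shift x r)).
Proof.
congr End; apply: tail_equal_end; apply: ray_shift_tail_equal.
by apply: end_of_tail_equal; rewrite /end_of reprK.
Qed.

Lemma tree_act1 w : tree_act 1%g w = w.
Proof.
case: w => [x|e] /=; first by rewrite mul1g.
by rewrite ray_shift1 /end_of reprK.
Qed.

Lemma tree_actM x y w : tree_act (x * y)%g w = tree_act x (tree_act y w).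
Proof.
case: w => [v|e]; first by rewrite /= mulgA.
by have [r _ ->] := root_ray e; rewrite !tree_act_end_of ray_shiftM.
Qed.

Lemma tree_actK x : cancel (tree_act x) (@tree_act k l x^-1%g).
Proof. by move=> w; rewrite -tree_actM mulVg tree_act1. Qed.

Lemma geodesic_tree_act x y w : (size (word x) <= size (word y))%N ->
  geodesic w y -> geodesic (tree_act x w) (x * y)%g.
Proof.
case: w => [v|e] xy.
  move=> /= /prefix_edist yv; apply/prefix_edist; exact: prefix_mul xy yv.
have [r _ ->] := root_ray e; move=> /geodesic_end_of[N Nr].
rewrite tree_act_end_of; apply/geodesic_end_of; exists N => n /Nr.
exact: prefix_mul xy.
Qed.

Lemma geodesic_at e n : exists2 x : tree k l,
  size (word x) = n & geodesic (End e) x.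
Proof.
have [r r0 ->] := root_ray e; exists (r n); first exact: ray_size.
by apply/geodesic_root => //; rewrite ray_size.
Qed.

(** A vertex is [good] when [Q] has members of every greater length beyond it. As there are finitely
    many letters, some one-letter extension of a good vertex is good, and iterating this choice from
    the root gives the ray. *)
Lemma koenig (Q : tree k l -> Prop) :
  (forall x y, prefix (word x) (word y) -> Q y -> Q x) ->
  (forall n, exists2 x, size (word x) = n & Q x) ->
  exists2 r : ray k l, r 0%N = 1%g & forall n, Q (r n).
Proof.
move=> Qprefix Qn.
pose good x := forall n, (size (word x) <= n)%N ->
  exists y, [/\ size (word y) = n, prefix (word x) (word y) & Q y].
have good1 : good 1%g.
  by move=> n _; have [y yn Qy] := Qn n; exists y; split => //; exact: prefix0s.
have goodS x : good x -> exists2 y, good y &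
    prefix (word x) (word y) /\ size (word y) = (size (word x)).+1.
  move=> gx; apply: contrapT => nx.
  have bad a : exists N, forall y, prefix (rcons (word x) a) (word y) ->
      (N <= size (word y))%N -> ~ Q y.
    apply: contrapT => H; apply: nx.
    have H' n : exists y, [/\ (n <= size (word y))%N,
        prefix (rcons (word x) a) (word y) & Q y].
      apply: contrapT => H'; apply: H; exists n => y xy ny Qy; apply: H'.
      by exists y.
    have [y0 [_ xy0 _]] := H' 0%N.
    have r0 : reduced (rcons (word x) a).
      by case/prefixP: xy0 => s ys; have := word_reduced y0;
        rewrite ys => /cat_sorted2[].
    exists (Tree r0); last by rewrite /= prefix_rcons size_rcons.
    move=> n xn; have [y [ny xy Qy]] := H' n.
    exists (tree_take n y); rewrite size_tree_take//; split => //.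
      apply: (prefix_comparable xy (prefix_tree_take _ _)).
      by rewrite size_tree_take.
    exact: Qprefix (prefix_tree_take n y) Qy.
  have [N Nbad] := choice bad.
  (* This length exceeds that of [x], so [y] continues [x] by some letter [a], and it is at least
     [N a] for every [a], which contradicts [Nbad]. *)
  have [//|y [yn xy Qy]] := gx (\max_a N a + (size (word x)).+1)%N.
    by rewrite addnS ltnW// ltnS leq_addl.
  case/prefixP: xy => -[|a u] yE.
    move: yn => /eqP; rewrite yE cats0.
    by rewrite addnS -addSn -[X in X == _]add0n eqn_add2r.
  apply: (Nbad a y) => //; first by rewrite yE -cat_rcons prefix_prefix.
  by rewrite yn (leq_trans _ (leq_addr _ _))//; exact: leq_bigmax.
have goodS' (g : {x | good x}) : exists g' : {x | good x},
    prefix (word (sval g)) (word (sval g')) /\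
    size (word (sval g')) = (size (word (sval g))).+1.
  by case: g => x gx; have [y gy xy] := goodS x gx; exists (exist _ y gy).
have [f fP] := choice goodS'.
pose s n := sval (iter n f (exist _ _ good1)).
have szs n : size (word (s n)) = n.
  by elim: n => // n IHn; rewrite /s iterS (proj2 (fP _)) -/(s n) IHn.
have pres m n : prefix (word (s m)) (word (s (m + n)%N)).
  elim: n => [|n IHn]; first by rewrite addn0 prefix_refl.
  by rewrite addnS; apply: prefix_trans IHn (proj1 (fP _)).
have geo m n : edist (s m) (s (m + n)%N) = n.
  have /prefix_edist := pres m n.
  by rewrite !edist1x !szs => /eqP; rewrite eqn_add2l => /eqP.
exists (Ray geo) => // n /=.
have [y [_ sy /(Qprefix _ _)]] := svalP (iter n f (exist _ _ good1)) _ (leqnn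
  _).
exact.
Qed.

End rays.

Lemma third_element (T : finType) (a b : T) : (2 < #|T|)%N ->
  exists2 c, c != a & c != b.
Proof.
move=> T3; have /subsetPn[c _] : ~~ ([set: T]%SET \subset [set a; b]%SET).
  apply: contraTN T3 => /subset_leq_card; rewrite cardsT -leqNgt => /leq_trans.
  by apply; rewrite cards2; case: (a != b).
by rewrite !inE negb_or => /andP[ca cb]; exists c.
Qed.

(* The elements of the orbit leave the geodesic ray of [e] at distinct
   vertices. *)
Lemma end_orbit_infinite k l (e : tree_end k l) : (2 < #|{: letter k l}|)%N ->
  exists u : nat -> tree k l, injective (fun n => tree_act (u n) (End e)).
Proof.
move=> q3; have [r r0 ->] := root_ray e.
case r1 : (word (r 1%N)) (ray_size 1 r0) => [//|a [|//]] _.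
have rE n : exists p, word (r n.+1) = a :: p.
  have := ray_prefix r0 (ltn0Sn n); rewrite r1 => /prefixP[p ->].
  by exists p.
have uP n : exists u, exists v,
    [/\ geodesic (tree_act u (End (end_of r))) v, size (word v) = n.+2,
        prefix (word (r n.+1)) (word v) & v <> r n.+2].
  have [p pE] := rE n.
  case/prefixP: (ray_prefix r0 (leqnSn n.+1)) => -[|b [|b' s]] bE.
  - by have := ray_size n.+2 r0; rewrite bE cats0 ray_size// => /eqP;
    rewrite ltn_eqF.
  (* The translation is by [r n.+1] followed by [c] and [c']. The letter [c] leaves the ray, being
     different from its next letter [b]; [c'] shields [c] by not cancelling against the first letter
     [a] of the ray. *)
  - have [c cp cb] := third_element (linv (last a p)) b q3.
    have [c' c'c c'a] := third_element (linv c) (linv a) q3.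
    have ac' : a != linv c'.
      by apply: contraNneq c'a => ->; rewrite linvK.
    have rv : reduced (rcons (a :: p) c).
      rewrite /reduced /= rcons_path cp andbT.
      by have := word_reduced (r n.+1); rewrite pE.
    have ru : reduced (rcons (rcons (a :: p) c) c').
      by rewrite /reduced /= rcons_path last_rcons c'c andbT.
    exists (Tree ru), (Tree rv); split.
    + rewrite tree_act_end_of; apply/geodesic_end_of; exists 1%N => -[//|m] _.
      have [p' p'E] := rE m.
      rewrite [X in prefix _ X](_ : _ = mulw (rcons (rcons (a :: p) c) c') (a
        :: p')).
        rewrite mulw_cat; first by rewrite cat_rcons prefix_prefix.
        have := word_reduced (r m.+1); rewrite p'E.
        move: ru; rewrite /reduced /= cat_path /= => -> ->.
        by rewrite last_rcons ac'.
      by rewrite -p'E.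
    + by rewrite /= size_rcons; have := ray_size n.+1 r0; rewrite pE /= => ->.
    + by rewrite pE; exact: prefix_rcons.
    + move=> /(congr1 (@word k l)) /=; rewrite bE pE -cats1 /= => -[].
      by move=> /eqP; rewrite eqseq_cat// eqxx /= eqseq_cons andbT (negPf cb).
  - have := ray_size n.+2 r0; rewrite bE size_cat ray_size//= => /eqP.
    by rewrite !addnS !eqSS addSn gtn_eqF// ltnS leq_addr.
have [u /choice[v uv]] := choice uP.
exists u => m n.
wlog mn : m n / (m <= n)%N => [H|].
  by case: (leqP m n) => [|/ltnW] mn E; [|symmetry]; apply: H.
move: mn; rewrite leq_eqVlt => /orP[/eqP//|mn] E.
have [vm sm _ []] := uv m; have [vn sn pn _] := uv n.
apply: geodesic_size_inj vm _ _; last by rewrite sm ray_size.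
rewrite E; apply: geodesic_prefix vn; apply: prefix_trans pn.
exact: ray_prefix.
Qed.

(** * Topology of the compactification *)

Section topology_of_compactification.
Variables r k l : nat.
Hypothesis q2 : (1 < branching k l)%N.
Implicit Types (x y : tree k l) (e : tree_end k l) (w : hat_tree k l)
  (z : hat_conf r k l) (b : compactification r k l).

Definition cone x : set (hat_tree k l) := [set w | geodesic w x].

Lemma nbhs_rho w (A : set (hat_tree k l)) :
  nbhs w A <-> exists2 eps : rat, 0 < eps & forall w', rho w w' < eps -> A w'.
Proof.
split=> [/nbhs_ballP[eps /= eps0 sub]|[eps eps0 sub]]; first by exists eps.
by apply/nbhs_ballP; exists eps.
Qed.

Lemma rho_lt w w' n : rho w w' < (branching k l)%:R ^- n ->
  w = w' \/ exists y, [/\ geodesic w y, geodesic w' y & (n < size (word y))%N].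
Proof.
rewrite /rho; case: eqVneq => [->|ww']; first by left.
rewrite ltf_pV2 ?posrE ?exprn_gt0 ?ltr0n ?(ltnW q2)// -!natrX ltr_nat.
rewrite ltn_exp2l// => nc; right.
have [c0|[y [wy w'y yE]]] := confluent_attained ww'; first by rewrite c0 in nc.
by exists y; split => //; rewrite yE.
Qed.

Lemma rho_geodesic w w' y : geodesic w y -> geodesic w' y ->
  rho w w' <= (branching k l)%:R ^- size (word y).
Proof.
move=> wy w'y; rewrite /rho; case: eqVneq => [_|ww'].
  by rewrite invr_ge0 exprn_ge0.
rewrite lef_pV2 ?posrE ?exprn_gt0 ?ltr0n ?(ltnW q2)// -!natrX ler_nat.
by rewrite leq_exp2l//; exact: geodesic_leq.
Qed.

Lemma nbhs_vertex x (A : set (hat_tree k l)) :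
  nbhs (Vertex x) A <-> A (Vertex x).
Proof.
split=> [/nbhs_singleton//|Ax]; apply/nbhs_rho.
exists ((branching k l)%:R ^- size (word x)).
  by rewrite invr_gt0 exprn_gt0// ltr0n ltnW.
move=> w /rho_lt[<-//|[y [/prefix_edist/size_prefix xy _]]].
by rewrite ltnNge xy.
Qed.

Lemma nbhs_end e (A : set (hat_tree k l)) :
  nbhs (End e) A <-> exists2 x, geodesic (End e) x & cone x `<=` A.
Proof.
split=> [/nbhs_rho[eps eps0 sub]|[x ex sub]].
  have [n neps] : exists n : nat, (branching k l)%:R ^- n < eps.
    exists (Num.bound eps^-1);
      rewrite invf_plt ?posrE// ?exprn_gt0 ?ltr0n ?(ltnW q2)//.
    rewrite (lt_le_trans (archi_boundP _)) ?invr_ge0 1?ltW//.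
    by rewrite -natrX ltr_nat ltn_expl.
  have [x xn ex] := geodesic_at e n; exists x => // w wx; apply: sub.
  by rewrite (le_lt_trans _ neps)// -xn; exact: rho_geodesic.
apply/nbhs_rho; exists ((branching k l)%:R ^- size (word x)).
  by rewrite invr_gt0 exprn_gt0// ltr0n ltnW.
move=> w /rho_lt[<-|[y [ey wy xy]]]; first exact: sub.
apply: sub; apply: geodesic_prefix wy.
exact: geodesic_total ey ex (ltnW xy).
Qed.

Lemma nbhs_hat_conf z (A : set (hat_conf r k l)) :
  nbhs z A <-> exists F : {fset tree k l},
    forall z', {in F, z' =1 z} -> A z'.
Proof.
split=> [zA|[F FA]].
  (* The sets containing a cylinder around [z] form a filter which converges to [z] in each discrete
     coordinate, hence in the product topology; so every neighbourhood of [z] belongs to it. *)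
  pose C := [set B : set (hat_conf r k l) | exists F : {fset tree k l},
    forall z', {in F, z' =1 z} -> B z'].
  have CF : Filter C.
    split; first by exists fset0 => z'.
      move=> B D [F FB] [G GD]; exists (F `|` G)%fset => z' FG; split.
        by apply: FB => y yF; apply: FG; rewrite inE yF.
      by apply: GD => y yG; apply: FG; rewrite inE yG orbT.
    by move=> B D BD [F FB]; exists F => z' /FB/BD.
  suff /(_ _ zA) : cvg_to C (nbhs z) by [].
  have surj t : range (fun z' : hat_conf r k l => z' t) = setT.
    by rewrite eqEsubset; split=> v // _; exists (fun=> v).
  apply/cvg_sup => t; apply/cvg_image; first exact: surj.
  move=> B zB; exists ((fun z' : hat_conf r k l => z' t) @^-1` B).
    exists [fset t]%fset => z' /(_ t (fset11 t)) /= ->.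
    exact: nbhs_singleton zB.
  by rewrite image_preimage.
apply: (@filterS _ _ _ (\bigcap_(y in [set` F]) [set z' : hat_conf r k l | z' y
  = z y])).
  by move=> z' z'F; apply: FA => y yF; exact: z'F.
apply: filter_bigI => y yF.
have /(_ [set z y]) := @proj_continuous (tree k l) (fun=> lamp_state r) y z.
by apply; exact: discrete_set1.
Qed.

Lemma nbhs_compactification b (A : set (compactification r k l)) :
  nbhs b A <-> exists (F : {fset tree k l}) (W : set (hat_tree k l)),
    nbhs b.2 W /\ forall b', {in F, b'.1 =1 b.1} -> W b'.2 -> A b'.
Proof.
split=> [[[Z W] /= [/nbhs_hat_conf[F FZ] bW] ZWA]|[F [W [bW FWA]]]].
  by exists F, W; split => // -[z w] /= zF wW; apply: ZWA; split => //;
    exact: FZ.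
exists ([set z : hat_conf r k l | {in F, z =1 b.1}], W);
  last by move=> b' [b'F b'W]; exact: FWA.
by split => //; apply/nbhs_hat_conf; exists F.
Qed.

Lemma open_cone x : open (cone x).
Proof.
rewrite openE => -[y|e] xw; first by apply/nbhs_vertex.
by apply/nbhs_end; exists x.
Qed.

Lemma closed_cone x : closed (cone x).
Proof.
rewrite -[cone x]setCK closedC openE => -[y|e] xw; first by apply/nbhs_vertex.
apply/nbhs_end; have [y yx ey] := geodesic_at e (size (word x)).
exists y => // w wy wx; apply: xw; rewrite /cone /=.
by rewrite (geodesic_size_inj wx wy yx).
Qed.

Lemma open_vertex x : open [set Vertex x].
Proof. by rewrite openE => _ ->; apply/nbhs_vertex. Qed.

Lemma closed_vertex x : closed [set Vertex x].
Proof.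
rewrite -[[set _]]setCK closedC openE => -[y|e] xw; first by apply/nbhs_vertex.
apply/nbhs_end; have [y yx ey] := geodesic_at e (size (word x)).+1.
exists y => // w wy wx; move: wy;
  rewrite /cone wx /= => /prefix_edist/size_prefix.
by rewrite yx ltnn.
Qed.

Definition cylinder (F : {fset tree k l}) (z : tree k l -> 'Z_r)
    (W : set (hat_tree k l)) : set (compactification r k l) :=
  [set b : compactification r k l | {in F, b.1 =1 z} /\ W b.2].

Lemma open_cylinder F z W : open W -> open (cylinder F z W).
Proof.
rewrite !openE => oW b [bz /oW bW]; apply/nbhs_compactification.
by exists F, W; split => // b' b'F b'W; split => // y yF; rewrite b'F// bz.
Qed.

Lemma closed_cylinder F z W : closed W -> closed (cylinder F z W).
Proof.
rewrite -openC => cW.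
rewrite -[cylinder _ _ _]setCK closedC openE => b nb.
apply/nbhs_compactification; have [bW|bW] := pselect (W b.2).
  exists F, setT; split; first exact: filterT.
  move=> b' bb' _ [b'z _]; apply: nb; split => // y yF.
  by rewrite -(b'z y yF) bb'.
exists fset0, (~` W); split; first exact: open_nbhs_nbhs.
by move=> b' _ b'W [_].
Qed.

(** A cylinder depends on its configuration only through the values on a finite set. Naming it by a
    finitely supported configuration keeps the base countable. *)
Let index : countType := ({fset tree k l} * conf r k l * (tree k l + tree k
  l))%type.

Definition basic (i : index) :
    set (compactification r k l) :=
  cylinder i.1.1 i.1.2
    match i.2 with inl x => [set Vertex x] | inr x => cone x end.

Lemma clopen_basic i : clopen (basic i).
Proof.
case: i => [[F z] [x|x]]; split.
- exact/open_cylinder/open_vertex.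
- exact/closed_cylinder/closed_vertex.
- exact/open_cylinder/open_cone.
- exact/closed_cylinder/closed_cone.
Qed.

Lemma basic_nbhs b A : nbhs b A -> exists2 i, basic i b & basic i `<=` A.
Proof.
move=> /nbhs_compactification[F [W [bW FWA]]].
have [z zE] : exists z : conf r k l, {in F, z =1 b.1}.
  by exists [fsfun y in F => b.1 y] => y yF; rewrite fsfunE yF.
case: b bW FWA zE => bz [x|e] /= bW FWA zE.
  exists (F, z, inl x).
    by split => //= y yF; rewrite zE.
  move=> [z' w] /= [/= z'z ->]; apply: FWA => /= [y yF|].
    by rewrite z'z// zE.
  exact: nbhs_singleton bW.
move/nbhs_end : bW => [x ex xW]; exists (F, z, inr x).
  by split => //= y yF; rewrite zE.
move=> [z' w] /= [/= z'z xw]; apply: FWA => /= [y yF|]; last exact: xW.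
by rewrite z'z// zE.
Qed.

(** Countability of the union is what lets clopen sets generate the Borel sets in [borel_clopen]. *)
Lemma open_bigcup_clopen (U : set (compactification r k l)) : open U ->
  exists2 V : nat -> set (compactification r k l),
    (forall n, clopen (V n)) & U = \bigcup_n V n.
Proof.
move=> oU.
pose V n := if @choice.unpickle index n is Some i
  then if `[< basic i `<=` U >] then basic i else set0 else set0.
exists V.
  move=> n; rewrite /V; case: choice.unpickle => [i|]; last exact: clopen0.
  by case: ifPn => _; [exact: clopen_basic|exact: clopen0].
apply/seteqP; split=> [b Ub|b [n _]].
  have [i ib iU] := basic_nbhs (open_nbhs_nbhs (conj oU Ub)).
  by exists (choice.pickle i) => //; rewrite /V choice.pickleK; case: asboolP.
by rewrite /V; case: choice.unpickle => [i|//]; case: asboolP => // + ib; exact.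
Qed.

Lemma tree_act_continuous x : continuous (@tree_act k l x).
Proof.
move=> [y|e] A; first by move=> /nbhs_vertex; rewrite nbhs_simpl => ?;
  apply/nbhs_vertex.
rewrite [tree_act x (End e)]/= => /nbhs_end[y ey yA].
(* Multiplication by [x] shortens a word by at most [size (word x)] letters, so the image of [u] is
   still at least as long as [y]. *)
have [u ux eu] := geodesic_at e (size (word x) + size (word y))%N.
rewrite nbhs_simpl; apply/nbhs_end; exists u => // w uw; apply: yA.
have xu : (size (word x) <= size (word u))%N by rewrite ux leq_addr.
apply: geodesic_prefix (geodesic_tree_act xu uw).
apply: geodesic_total (geodesic_tree_act xu eu) ey _.
by rewrite -(leq_add2l (size (word x))) -ux size_mul_ge.
Qed.

Lemma act_continuous (g : lamplighter r k l) : continuous (act g).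
Proof.
move=> b A /nbhs_compactification[F [W [/tree_act_continuous bW FWA]]].
rewrite nbhs_simpl; apply/nbhs_compactification.
exists [fset (pos g)^-1 * y | y in F]%g%fset, (tree_act (pos g) @^-1` W).
split => // b' bb' b'W; apply: FWA => //= y yF.
by rewrite bb'// in_imfset.
Qed.

Definition ends : set (hat_tree k l) := [set w | exists e, w = End e].

(** Finitely many branches at each level cover the ends, so an ultrafilter on the ends selects a
    branch at each level; Koenig's lemma joins them into a ray, whose end is the limit. *)
Lemma ends_compact : compact ends.
Proof.
rewrite compact_ultra => G GU Gends.
have sub x y : prefix (word x) (word y) -> G (cone y) -> G (cone x).
  by move=> xy; apply: filterS => w; exact: geodesic_prefix.
have all_n n : exists2 x, size (word x) = n & G (cone x).
  elim: n => [|n [x xn Gx]].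
    exists 1%g => //; apply: filterS Gends => _ [e ->] /=.
    by have [y y0 ey] := geodesic_at e 0; apply: geodesic_prefix ey;
      exact: prefix0s.
  apply: contrapT => H.
  (* The existential makes [C a] empty when appending [a] does not give a reduced word, so that all
     letters are treated alike. *)
  pose C (a : letter k l) := [set w | exists2 y, word y = rcons (word x) a &
    cone y w].
  have nC a : G (~` C a).
    have [GC|//] := in_ultra_setVsetC (C a) GU; exfalso; apply: H.
    have [_ [y yx _]] := filter_ex GC; exists y;
      first by rewrite yx size_rcons xn.
    apply: filterS GC => w [y' y'x]; suff -> : y' = y by [].
    by apply: val_inj; rewrite /= y'x yx.
  have Gall : G (fun w => forall a, (~` C a) w) by exact: filter_forall.
  have [w [[xw [e we]] nw]] := filter_ex (filterI (filterI Gx Gends) Gall).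
  subst w; have [y yn ey] := geodesic_at e n.+1.
  have /prefixP[s ys] : prefix (word x) (word y).
    by apply: geodesic_total ey xw _; rewrite yn xn.
  move: yn; rewrite ys size_cat xn -addn1 => /eqP; rewrite eqn_add2l.
  case: s ys => [//|a [|//]] ys _.
  by apply: (nw a); exists y; rewrite // ys cats1.
have [s s0 Gs] := koenig sub all_n.
exists (End (end_of s)); split; first by exists (end_of s).
by move=> A /nbhs_end[x /(geodesic_root _ s0) xs] /filterS; apply; rewrite -xs.
Qed.

Lemma boundaryE : @boundary r k l = [set: hat_conf r k l] `*` ends.
Proof. by apply/seteqP; split => [b|b []]. Qed.

Lemma boundary_compact : compact (@boundary r k l).
Proof.
rewrite boundaryE; apply: compact_setX ends_compact.
have lamps_compact : compact [set: lamp_state r].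
  by apply: finite_compact; exact: (@finite_finset 'Z_r setT).
have := @tychonoff (tree k l) (fun=> lamp_state r) _ (fun=> lamps_compact).
by rewrite (_ : [set f | _] = setT)//; apply/seteqP; split.
Qed.

Lemma boundary_closed : closed (@boundary r k l).
Proof.
rewrite -[@boundary r k l]setCK closedC openE => -[z [x|e]] nb; last first.
  by exfalso; apply: nb; exists e.
apply/nbhs_compactification; exists fset0, [set Vertex x].
split; first exact/nbhs_vertex.
by move=> b _ bx [e be]; move: bx; rewrite be.
Qed.

End topology_of_compactification.

(** * Measures and countable fibers *)

Section fibers.
Local Open Scope ereal_scope.
Context d (T : measurableType d) (R : realType) (mu : {measure set T -> \bar
  R}).
Context (C : countType) (g : T -> C).
Hypothesis mg : forall c, measurable (g @^-1` [set c]).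

Lemma measurable_preimage_fibers (B : set C) : measurable (g @^-1` B).
Proof.
rewrite (_ : g @^-1` B = \bigcup_n
    if @choice.unpickle C n is Some c then g @^-1` ([set c] `&` B) else set0).
  apply: bigcupT_measurable => n; case: choice.unpickle => [c|//].
  have [Bc|nBc] := pselect (B c); first by rewrite setIidl// => _ ->.
  by rewrite (_ : _ `&` _ = set0) ?preimage_set0//; apply/seteqP;
    split=> // _ [-> /nBc].
apply/seteqP; split=> [x Bx|x [n _]].
  by exists (choice.pickle (g x)) => //; rewrite choice.pickleK.
by case: choice.unpickle => // c [].
Qed.

(** Total expectation for a discrete variable. The codes of [C] turn the fibers into a sequence of
    disjoint pieces, empty at numbers that code nothing. *)
Lemma ge0_integral_fibers (A : set T) (f : T -> \bar R) : measurable A ->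
  measurable_fun A f -> (forall x, A x -> 0 <= f x) ->
  \int[mu]_(x in A) f x =
  \esum_(c in [set: C]) \int[mu]_(x in A `&` g @^-1` [set c]) f x.
Proof.
move=> mA mf f0.
pose F n := A `&` [set x | choice.pickle (g x) = n].
have AE : A = \bigcup_n F n.
  apply/seteqP; split=> [x Ax|x [n _ []]//].
  by exists (choice.pickle (g x)).
have FE c : F (choice.pickle c) = A `&` g @^-1` [set c].
  rewrite /F; congr (_ `&` _); apply/seteqP; split=> x /=; last by move=> ->.
  exact: (pcan_inj choice.pickleK).
have F0 n : ~ range (@choice.pickle C) n -> F n = set0.
  by move=> nC; apply/seteqP; split=> // x [_ xn]; apply: nC; exists (g x).
have mF n : measurable (F n).
  have [[c _ <-]|/F0->//] := pselect (range (@choice.pickle C) n).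
  by rewrite FE; exact: measurableI.
rewrite {1}AE ge0_integral_bigcup//; first last.
- move=> m n _ _ [x [[_ <-] [_ ->]]]; exact: erefl.
- by rewrite -AE.
- by rewrite -AE.
rewrite nneseries_esumT; last first.
  by move=> n; apply: integral_ge0 => x [/f0].
under [RHS]eq_esum => c _ do rewrite -FE.
rewrite -(@esum_image _ _ _ [set: C] choice.pickle (fun n => \int[mu]_(x in F
  n) f x)); last first.
  by move=> c c' _ _; exact: (pcan_inj choice.pickleK).
rewrite [RHS]esum_mkcond; apply: eq_esum => n _; case: ifPn => // /negP nC.
by rewrite F0 ?integral_set0// => /mem_set.
Qed.

Lemma measure_fibers (A : set T) : measurable A ->
  mu A = \esum_(c in [set: C]) mu (A `&` g @^-1` [set c]).
Proof.
move=> mA; rewrite -[LHS]mul1e -integral_cst// ge0_integral_fibers//.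
by apply: eq_esum => c _; rewrite integral_cst ?mul1e//; exact: measurableI.
Qed.

Lemma measure_fibers_in (B : set C) (A : set T) : measurable A ->
  mu (A `&` g @^-1` B) = \esum_(c in B) mu (A `&` g @^-1` [set c]).
Proof.
move=> mA.
have mB := measurable_preimage_fibers B.
rewrite measure_fibers; last exact: measurableI.
rewrite [RHS]esum_mkcond; apply: eq_esum => c _; case: ifPn => cB.
  congr (mu _); rewrite -setIA; congr (_ `&` _).
  by apply/seteqP; split=> [x []//|x /= ->]; split => //; exact: set_mem.
rewrite (_ : _ `&` _ = set0) ?measure0//; apply/seteqP;
  split=> // x [[_ Bx] /= gx].
by move/negP: cB; apply; rewrite -gx; exact: mem_set.
Qed.

End fibers.

Lemma ge0_esumZl (R : realType) (I : choiceType) (D : set I) (a : I -> \bar R)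
    (c : R) : 0 <= c -> (forall i, 0 <= a i)%E ->
  (\esum_(i in D) (c%:E * a i) = c%:E * \esum_(i in D) a i)%E.
Proof.
move=> c0 a0; rewrite /esum -ereal_supZl//; last first.
  by apply/set0P; exists 0%E, set0; [exact: fsets_set0|rewrite fsbig_set0].
congr ereal_sup; rewrite image_comp; apply/eq_imagel => F [finF FD] /=.
by rewrite ge0_mule_fsumr.
Qed.

Section convergence_of_probabilities.
Context d (T : measurableType d) (R : realType) (P : probability T R).

(** The indicators are eventually constant almost everywhere and bounded by 1, so dominated
    convergence applies. *)
Lemma near_eq_measure_cvg (E_ : nat -> set T) (E : set T) :
  (forall n, measurable (E_ n)) -> measurable E ->
  {ae P, forall x, \forall n \near \oo, E_ n x <-> E x} ->
  P (E_ n) @[n --> \oo] --> P E.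
Proof.
move=> mE_ mE EE.
have [] := @dominated_convergence _ T R P setT measurableT
  (fun n x => (\1_(E_ n) x)%:E) (fun x => (\1_E x)%:E) (cst 1%E).
- by move=> n; apply/measurable_EFinP; exact: measurable_indic.
- by apply/measurable_EFinP; exact: measurable_indic.
- apply: filterS EE => x EEx _; apply: cvg_near_cst.
  apply: filterS EEx => n EnE; rewrite !indicE.
  by congr ((nat_of_bool _)%:R%:E); apply/idP/idP; rewrite !inE => /EnE.
- exact: finite_measure_integrable_cst.
- by apply: aeW => x n _ /=; rewrite indicE; case: (_ \in _);
  rewrite !(normr1, normr0) lee_fin.
move=> _ _; rewrite integral_indic// setIT.
by under eq_fun => n do rewrite integral_indic// setIT.
Qed.

End convergence_of_probabilities.

Lemma ge0_integral_mrestr d (T : measurableType d) (R : realType)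
    (mu : {measure set T -> \bar R}) (D : set T) (mD : measurable D)
    (f : T -> \bar R) : measurable_fun setT f -> (forall x, 0 <= f x)%E ->
  (\int[mrestr mu mD]_x f x = \int[mu]_(x in D) f x)%E.
Proof.
move=> mf f0; rewrite [LHS](@ge0_negligible_integral _ _ _ _ _ (~` D))//;
  first last.
- by rewrite /= /mrestr setICl measure0.
- exact: measurableC.
rewrite setTD setCK; apply: eq_measure_integral => A mA AD.
by rewrite /= /mrestr setIidl.
Qed.

(** * The random walk and its limit *)

Section random_walk.
Local Open Scope ereal_scope.
Variables (R : realType) (r k l : nat).
Local Notation Gamma := (lamplighter r k l).
Variables (mu : probability Gamma R).
Variables (d : measure_display) (Omega : measurableType d)
  (P : probability Omega R) (X : nat -> {RV P >-> Gamma}).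
Hypothesis X_law : forall n A, distribution P (X n) A = mu A.
Hypothesis X_indep : independent X.

Lemma measurable_increment n (A : set Gamma) : measurable (X n @^-1` A).
Proof. by rewrite -[_ @^-1` _]setTI; exact: measurable_funPT. Qed.

Lemma increments_law n (A : nat -> set Gamma) :
  P (\bigcap_(i in `I_n) X i @^-1` A i) = \prod_(i < n) mu (A i).
Proof.
have := X_indep [fset i in iota 0 n]%fset A.
rewrite (_ : [set` _] = `I_n); last first.
  by apply/seteqP; split=> i /=; rewrite !inE mem_iota.
move=> ->; rewrite (perm_big (iota 0 n)) /=; last first.
  by apply: uniq_perm (fset_uniq _) (iota_uniq _ _) _ => i; rewrite !inE.
rewrite -{1}[n]subn0 -/(index_iota 0 n) big_mkord.
by apply: eq_bigr => i _; exact: X_law.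
Qed.

Definition increments (m n : nat) (omega : Omega) : n.-tuple Gamma :=
  [tuple X (m + i)%N omega | i < n].

Lemma increments_fiber m n (t : n.-tuple Gamma) :
  increments m n @^-1` [set t] =
  \bigcap_(i in `I_n) X (m + i)%N @^-1` [set nth 1%g t i].
Proof.
apply/seteqP; split=> omega /=.
  move=> <- i /= iN;
    have := tnth_mktuple (fun i : 'I_n => X (m + i)%N omega) (Ordinal iN).
  by rewrite (tnth_nth 1%g).
move=> H; apply/eq_from_tnth => i; rewrite tnth_mktuple (tnth_nth 1%g).
exact: (H i (ltn_ord i)).
Qed.

Lemma measurable_increments m n (t : n.-tuple Gamma) :
  measurable (increments m n @^-1` [set t]).
Proof.
rewrite increments_fiber; apply: bigcap_measurableType => i _.
exact: measurable_increment.
Qed.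

(** The form in which independence enters all later arguments. Both sides are summed over the values
    of the tuple, where the product formula for cylinder events is available. *)
Lemma shift_increments_law n x (B : set (n.-tuple Gamma)) :
  P (X 0 @^-1` [set x] `&` increments 1 n @^-1` B) =
  mu [set x] * P (increments 0 n @^-1` B).
Proof.
rewrite (measure_fibers_in P (@measurable_increments 1 n)) ;
  last exact: measurable_increment.
rewrite -[X in _ * P X]setTI (measure_fibers_in P (@measurable_increments 0
  n))//.
rewrite -[mu [set x]]fineK ?fin_num_measure// -ge0_esumZl ?fine_ge0//.
apply: eq_esum => t _; rewrite setTI fineK ?fin_num_measure//.
rewrite !increments_fiber.
(* The entry [j] of the tuple is prescribed for the increment [j.+1], position 0 being taken by
   [x]. *)
pose A i : set Gamma := if i is j.+1 then [set nth 1%g t j] else [set x].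
rewrite (_ : _ `&` _ = \bigcap_(i in `I_n.+1) X i @^-1` A i); last first.
  apply/seteqP; split=> [omega [X0 H] [//|i] /= iN|omega H]; first exact: H.
  split; first exact: (H 0%N).
  by move=> i iN; exact: (H i.+1).
transitivity (\prod_(i < n.+1) mu (A i)); first exact: increments_law.
rewrite big_ord_recl; congr (_ * _); apply/esym.
exact: (increments_law n (fun i => [set nth 1%g t i])).
Qed.

Definition tuple_prod n (t : n.-tuple Gamma) : Gamma := (\prod_(h <- t) h)%g.

Lemma walk_increments g n omega :
  walk g (fun i => X i) n omega = (g * tuple_prod (increments 0 n omega))%g.
Proof.
rewrite /walk /tuple_prod /increments; congr (_ * _)%g.
by rewrite big_mkord big_tuple; apply: eq_bigr => i _; rewrite tnth_mktuple.
Qed.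

Lemma walkS_increments n omega :
  walk 1%g (fun i => X i) n.+1 omega =
  (X 0 omega * tuple_prod (increments 1 n omega))%g.
Proof.
rewrite /walk mul1g big_nat_recl//; congr (_ * _)%g.
rewrite /tuple_prod big_mkord big_tuple.
by apply: eq_bigr => i _; rewrite tnth_mktuple.
Qed.

Lemma measurable_walk n (A : set Gamma) :
  measurable (walk 1%g (fun i => X i) n @^-1` A).
Proof.
rewrite (_ : walk _ _ _ @^-1` A =
    increments 0 n @^-1` [set t | A (tuple_prod t)]).
  exact/measurable_preimage_fibers/measurable_increments.
by apply/seteqP; split=> omega /=; rewrite walk_increments mul1g.
Qed.

Lemma walk_first_step n x (A : set Gamma) :
  P (X 0 @^-1` [set x] `&` walk 1%g (fun i => X i) n.+1 @^-1` A) =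
  mu [set x] * P (walk 1%g (fun i => X i) n @^-1` [set g | A (x * g)%g]).
Proof.
rewrite (_ : _ `&` _ = X 0 @^-1` [set x] `&`
    increments 1 n @^-1` [set t | A (x * tuple_prod t)%g]); last first.
  by apply/seteqP; split=> omega [/= <-]; rewrite walkS_increments.
rewrite shift_increments_law; congr (_ * P _).
by apply/seteqP; split=> omega /=; rewrite walk_increments mul1g.
Qed.

End random_walk.

(** * The action on the compactification and its Borel structure *)

Section compactification_measure.
Variables r k l : nat.
Hypothesis q2 : (1 < branching k l)%N.
Local Notation Gamma := (lamplighter r k l).
Implicit Types (g h : Gamma) (b : compactification r k l).

Lemma act_embed g h : act g (embed h) = embed (g * h)%g.
Proof.
congr pair; apply/funext => y /=.
by rewrite conf_addE conf_shiftE.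
Qed.

Lemma actM g h b : act (g * h)%g b = act g (act h b).
Proof.
congr pair; last exact: tree_actM.
apply/funext => y /=; rewrite conf_addE conf_shiftE invgM addrA.
by rewrite mulgA.
Qed.

Lemma act1 b : act (1%g : Gamma) b = b.
Proof.
case: b => z w; congr pair; last exact: tree_act1.
by apply/funext => y /=; rewrite conf0E add0r invg1 mul1g.
Qed.

Lemma act_boundary g b : boundary b -> boundary (act g b).
Proof. by move=> [e be]; rewrite /boundary /= be; eexists. Qed.

(** The action is by bijections; as a preimage, the formula exhibits the translated law as a
    pushforward. *)
Lemma translateE (R : realType) (nu : set (borel r k l) -> \bar R) g :
  translate nu g = fun U => nu (act g @^-1` U).
Proof.
apply/funext => U; congr nu; apply/seteqP; split=> [_ [b Ub <-]|b Ub] /=.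
  by rewrite -actM mulgV act1.
by exists (act g b) => //; rewrite -actM mulVg act1.
Qed.

Lemma open_borel (U : set (compactification r k l)) : open U ->
  measurable (U : set (borel r k l)).
Proof. exact: sub_sigma_algebra. Qed.

Lemma closed_borel (U : set (compactification r k l)) : closed U ->
  measurable (U : set (borel r k l)).
Proof.
by rewrite -openC => /open_borel /measurableC; rewrite setCK.
Qed.

Lemma measurable_act g :
  measurable_fun setT (act g : borel r k l -> borel r k l).
Proof.
apply: (@measurability _ _ _ _ setT (act g : borel r k l -> borel r k l) (@open
  (compactification r k l))) => //.
move=> _ [U oU <-]; rewrite setTI; apply: open_borel.
by apply: open_comp => // b _; exact: act_continuous.
Qed.

(** Clopen sets are the ones on which convergence of the walk decides membership; together with
    stability under intersection, this makes them the test class for [first_step_law]. *)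
Lemma borel_clopen :
  @measurable _ (borel r k l) = <<s @clopen (compactification r k l) >>.
Proof.
apply/seteqP; split; last first.
  apply: smallest_sub; first exact: smallest_sigma_algebra.
  by move=> U [oU _]; exact: sub_sigma_algebra.
apply: smallest_sub; first exact: smallest_sigma_algebra.
move=> U oU; have [V cV ->] := open_bigcup_clopen q2 oU.
have [_ _ cup] := smallest_sigma_algebra setT (@clopen (compactification r k
  l)).
by apply: cup => n; apply: sub_gen_smallest; exact: cV.
Qed.

End compactification_measure.

(** * The first-step identity for the limit of the walk *)

Section first_step.
Local Open Scope ereal_scope.
Variables (R : realType) (r k l : nat).
Hypothesis q2 : (1 < branching k l)%N.
Local Notation Gamma := (lamplighter r k l).
Variables (mu : probability Gamma R).
Variables (d : measure_display) (Omega : measurableType d)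
  (P : probability Omega R) (X : nat -> {RV P >-> Gamma}).
Hypothesis X_law : forall n A, distribution P (X n) A = mu A.
Hypothesis X_indep : independent X.
Variable Zoo : {RV P >-> borel r k l}.
Hypothesis Zoo_lim : {ae P, forall omega,
  embed (walk 1%g X n omega) @[n --> \oo] --> (Zoo omega : compactification r k
    l)}.

Lemma measurable_Zoo (V : set (borel r k l)) : measurable V ->
  measurable (Zoo @^-1` V).
Proof. by move=> mV; rewrite -[_ @^-1` _]setTI; exact: measurable_funPT. Qed.

Lemma measurable_act_Zoo g :
  measurable_fun setT (fun omega => act g (Zoo omega) : borel r k l).
Proof. exact: measurableT_comp (measurable_act q2 g) (measurable_funPT Zoo).
  Qed.

Lemma walk_near_clopen (V : set (compactification r k l)) g : clopen V ->
  {ae P, forall omega, \forall n \near \oo,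
    V (embed (g * walk 1%g X n omega)%g) <-> V (act g (Zoo omega))}.
Proof.
move=> [oV cV]; apply: filterS Zoo_lim => omega lim.
have {lim} : embed (g * walk 1%g X n omega)%g @[n --> \oo] -->
    (act g (Zoo omega) : compactification r k l).
  under eq_fun do rewrite -act_embed.
  have := @cvg_comp _ _ _ (fun n => embed (walk 1%g X n omega)) (act g) _ _ _
    lim (@act_continuous r k l q2 g (Zoo omega)).
  exact.
have [VZ|nVZ] := pselect (V (act g (Zoo omega))) => lim.
  have : \forall n \near \oo, V (embed (g * walk 1%g X n omega)%g).
    exact: lim (open_nbhs_nbhs (conj oV VZ)).
  by apply: filterS => n Vn; split.
have : \forall n \near \oo, (~` V) (embed (g * walk 1%g X n omega)%g).
  by apply: lim; apply: open_nbhs_nbhs; split => //; exact: closed_openC.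
by apply: filterS => n Vn; split.
Qed.

(** The limit of [walk_first_step]: [walk_near_clopen] identifies the limit of either side, and
    limits are unique. *)
Lemma first_step_clopen x (V : set (compactification r k l)) : clopen V ->
  P (X 0 @^-1` [set x] `&` Zoo @^-1` V) =
  mu [set x] * P ((fun omega => act x (Zoo omega)) @^-1` V).
Proof.
move=> cV; have mV := open_borel (proj1 cV).
have cvg1 : P (X 0 @^-1` [set x] `&`
    walk 1%g (fun i => X i) n @^-1` [set g | V (embed g)]) @[n --> \oo] -->
    P (X 0 @^-1` [set x] `&` Zoo @^-1` V).
  apply: near_eq_measure_cvg => [n||].
  - apply: measurableI; first exact: measurable_increment.
    exact: measurable_walk.
  - by apply: measurableI; [exact: measurable_increment|exact: measurable_Zoo].
  apply: filterS (walk_near_clopen 1%g cV) => omega; apply: filterS => n.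
  by rewrite mul1g act1 /= => ->.
have cvg2 : P (walk 1%g (fun i => X i) n @^-1` [set g | V (embed (x * g)%g)])
    @[n --> \oo] --> P ((fun omega => act x (Zoo omega)) @^-1` V).
  apply: near_eq_measure_cvg => [n||].
  - exact: measurable_walk.
  - by rewrite -[_ @^-1` _]setTI; exact: measurable_act_Zoo.
  exact: walk_near_clopen.
have muf : mu [set x] \is a fin_num by exact: fin_num_measure.
have cvg2' := cvgeZl muf cvg2.
(* Time [n.+1] on the left is matched with time [n] on the right. *)
rewrite -cvg_shiftS in cvg1.
rewrite -(cvg_lim (@ereal_hausdorff R) cvg1) -(cvg_lim (@ereal_hausdorff R)
  cvg2').
apply: (congr1 (fun u : nat -> \bar R => lim (u @ \oo))); apply/funext => n.
exact: walk_first_step.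
Qed.

Let measurable_event x : measurable (X 0 @^-1` [set x]).
Proof. exact: measurable_increment. Qed.

(** Both sides are finite measures of [V]; they agree on the clopen sets, which are stable under
    intersection and generate the Borel sets. *)
Lemma first_step_law x (V : set (borel r k l)) : measurable V ->
  P (X 0 @^-1` [set x] `&` Zoo @^-1` V) =
  mu [set x] * P ((fun omega => act x (Zoo omega)) @^-1` V).
Proof.
move=> mV.
have mu0 : (0 <= fine (mu [set x]))%R by exact: fine_ge0.
(* The instances are named because their proofs of measurability cannot be
   inferred from the functions. *)
pose m1 : {measure set (borel r k l) -> \bar R} :=
  measure_function_pushforward__canonical__measure_function_Measure
    (mrestr P (measurable_event x)) (measurable_funPT Zoo).
pose m2 : {measure set (borel r k l) -> \bar R} :=
  mscale (NngNum mu0)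
  (measure_function_pushforward__canonical__measure_function_Measure
    P (measurable_act_Zoo x)).
have m2E U : m2 U = mu [set x] * P ((fun omega => act x (Zoo omega)) @^-1` U).
  by rewrite /m2 /= /mscale /= fineK// fin_num_measure.
have m1E U : m1 U = P (X 0 @^-1` [set x] `&` Zoo @^-1` U).
  by rewrite /m1 /= /pushforward /mrestr setIC.
rewrite -m1E -m2E.
apply: (@measure_unique _ R (borel r k l) (@clopen (compactification r k l))
  (fun=> setT) _ _ _ _ m1 m2) => //.
- exact: borel_clopen.
- exact: clopenI.
- by move=> _; exact: clopenT.
- by rewrite bigcup_const.
- by move=> U cU; rewrite m1E m2E; exact: first_step_clopen.
- by move=> _; rewrite m1E ltey_eq fin_num_measure//;
  apply: measurableI => //; exact: measurable_Zoo.
Qed.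

Lemma first_step_integral x (psi : borel r k l -> \bar R) :
  measurable_fun setT psi -> (forall b, 0 <= psi b) ->
  \int[P]_(omega in X 0 @^-1` [set x]) psi (Zoo omega) =
  mu [set x] * \int[P]_omega psi (act x (Zoo omega)).
Proof.
move=> mpsi psi0.
rewrite -(ge0_integral_mrestr _ (measurable_event x))//; last first.
  exact: measurableT_comp mpsi (measurable_funPT Zoo).
have mu0 : (0 <= fine (mu [set x]))%R by exact: fine_ge0.
transitivity (\int[pushforward (mrestr P (measurable_event x)) Zoo]_b psi b).
  by rewrite ge0_integral_pushforward.
transitivity (\int[mscale (NngNum mu0)
  (measure_function_pushforward__canonical__measure_function_Measure
    P (measurable_act_Zoo x))]_b psi b).
  apply: eq_measure_integral => A mA _.
  rewrite /= /mscale /= /pushforward fineK ?fin_num_measure// -first_step_law//.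
  by rewrite /mrestr setIC.
rewrite ge0_integral_mscale//= fineK ?fin_num_measure//; congr (_ * _).
by rewrite ge0_integral_pushforward//; exact: measurable_act_Zoo.
Qed.

End first_step.

(** * Exit points *)

Section exit_points.
Local Open Scope ereal_scope.
Variables (R : realType) (r k l : nat).
Hypothesis q2 : (1 < branching k l)%N.
Local Notation Gamma := (lamplighter r k l).
Variables (mu : probability Gamma R).
Hypothesis mu_irr : irreducible mu.
Variables (d : measure_display) (Omega : measurableType d)
  (P : probability Omega R) (X : nat -> {RV P >-> Gamma}).
Hypothesis X_law : forall n A, distribution P (X n) A = mu A.
Hypothesis X_indep : independent X.
Variable Zoo : {RV P >-> borel r k l}.
Hypothesis Zoo_boundary : forall omega, boundary (Zoo omega).
Hypothesis Zoo_lim : {ae P, forall omega,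
  embed (walk 1%g X n omega) @[n --> \oo] --> (Zoo omega : compactification r k
    l)}.

Definition over (w : hat_tree k l) : set (compactification r k l) :=
  [set b | b.2 = w].

Lemma measurable_over w : measurable (over w : set (borel r k l)).
Proof.
apply: closed_borel; rewrite -[over w]setCK closedC openE => b bw.
apply/nbhs_compactification => //; exists fset0, (~` [set w]); split => //.
apply: open_nbhs_nbhs; split => //; apply: closed_openC.
exact/accessible_closed_set1/hausdorff_accessible/metric_hausdorff.
Qed.

Definition exit_mass w : R := fine (P (Zoo @^-1` over w)).

Lemma exit_massE w : P (Zoo @^-1` over w) = (exit_mass w)%:E.
Proof.
rewrite fineK// fin_num_measure//; apply: measurable_Zoo.
exact: measurable_over.
Qed.

Lemma exit_mass_ge0 w : (0 <= exit_mass w)%R.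
Proof. exact: fine_ge0. Qed.

(** The number [N] exceeds the inverse of [c], so [N] disjoint events of mass at least [c] would
    have total mass above 1. *)
Lemma finitely_many_atoms (c : R) (w : nat -> hat_tree k l) : (0 < c)%R ->
  injective w -> ~ (forall n, c <= exit_mass (w n))%R.
Proof.
move=> c0 winj cw; pose N := Num.bound c^-1.
have tw : trivIset setT (fun n => Zoo @^-1` over (w n)).
  move=> m n _ _ [omega [/= wm wn]]; apply: winj.
  by rewrite -[LHS]wm -[RHS]wn.
have mw n : measurable (Zoo @^-1` over (w n)).
  by apply: measurable_Zoo; exact: measurable_over.
have := @measure_bigsetU _ R _ P _ mw tw N.
have : P (\big[setU/set0]_(i < N) (Zoo @^-1` over (w i))) <= 1.
  apply: probability_le1; apply: bigsetU_measurable => i _; exact: mw.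
move=> + E; rewrite E leNgt => /negP; apply.
apply: (@lt_le_trans _ _ (\sum_(i < N) c%:E)).
  rewrite sumEFin sumr_const card_ord lte_fin -[ltRHS]mulr_natr.
  by rewrite -ltr_pdivrMl// mulr1 (archi_boundP _)// invr_ge0 ltW.
by apply: lee_sum => i _; move: (cw i); rewrite -lee_fin -exit_massE; exact.
Qed.

Lemma preimage_over x w :
  (fun omega => act x (Zoo omega)) @^-1` over w =
  Zoo @^-1` over (tree_act (pos x)^-1%g w).
Proof.
apply/seteqP; split=> omega /=; first by move=> <-; rewrite tree_actK.
by rewrite /over /= => ->; rewrite -tree_actM mulgV tree_act1.
Qed.

Lemma first_step_exit x w :
  P (X 0 @^-1` [set x] `&` Zoo @^-1` over w) =
  mu [set x] * (exit_mass (tree_act (pos x)^-1%g w))%:E.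
Proof.
rewrite -exit_massE -preimage_over.
by apply: first_step_law => //; exact: measurable_over.
Qed.

(** By the first-step identity, the mass of [w] is the [mu]-average of the masses of its translates,
    none of which is larger; a translate of positive weight therefore cannot be smaller. The proof
    isolates the term of [x] and bounds the others by the maximum. *)
Lemma max_atom_step x w : (forall w', exit_mass w' <= exit_mass w)%R ->
  0 < mu [set x] -> exit_mass (tree_act (pos x)^-1%g w) = exit_mass w.
Proof.
move=> wmax mux; apply/eqP; rewrite eq_le wmax /=.
have mw := measurable_Zoo Zoo (measurable_over w).
have mX A := measurable_increment X 0 A.
have split_w : P (Zoo @^-1` over w) =
    P (X 0 @^-1` [set x] `&` Zoo @^-1` over w) +
    P (Zoo @^-1` over w `&` X 0 @^-1` (~` [set x])).
  rewrite [X in P X + _]setIC -measureU//.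
  - by rewrite -setIUr -preimage_setU setUv preimage_setT setIT.
  - exact: measurableI.
  - exact: measurableI.
  - by apply/seteqP; split=> // omega [[_ x0] [_ nx]]; exact: nx.
have rest : P (Zoo @^-1` over w `&` X 0 @^-1` (~` [set x])) <=
    (exit_mass w)%:E * mu (~` [set x]).
  rewrite measure_fibers_in//.
  apply: (@le_trans _ _ (\esum_(y in ~` [set x])
      (exit_mass w)%:E * P (setT `&` X 0 @^-1` [set y]))).
    apply: le_esum => y _; rewrite setIC setTI.
    have -> : P (X 0 @^-1` [set y]) = mu [set y] by exact: X_law.
    apply: le_trans (_ : mu [set y] * (exit_mass (tree_act (pos y)^-1%g w))%:E
      <= _).
      by rewrite -first_step_exit.
    by rewrite muleC lee_wpmul2r// lee_fin.
  rewrite ge0_esumZl ?exit_mass_ge0//.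
  have <- : P (X 0 @^-1` (~` [set x])) = mu (~` [set x]) by exact: X_law.
  by rewrite -(measure_fibers_in P (g := X 0))// setTI.
have muC : mu (~` [set x]) = (1 - fine (mu [set x]))%:E.
  by rewrite probability_setC// EFinB fineK// fin_num_measure.
have : (exit_mass w)%:E <= mu [set x] *
    (exit_mass (tree_act (pos x)^-1%g w))%:E + (exit_mass w)%:E * mu (~` [set
      x]).
  by rewrite -{1}exit_massE split_w first_step_exit leeD2l.
rewrite muC -[mu [set x]]fineK ?fin_num_measure// -!EFinM -EFinD lee_fin.
have : (0 < fine (mu [set x]))%R by rewrite fine_gt0// mux ltey_eq
  fin_num_measure.
set p := fine _; set a := exit_mass w; set a' := exit_mass _ => p0.
rewrite mulrBr mulr1 addrCA lerDl [(a * p)%R]mulrC -mulrBr pmulr_rge0//.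
by rewrite subr_ge0.
Qed.

Lemma max_atom_orbit g w : (forall w', exit_mass w' <= exit_mass w)%R ->
  exit_mass (tree_act g w) = exit_mass w.
Proof.
(* A step moves an atom by the inverse of a position, hence the factorisation of the inverse of [g].
   Its lamp part is arbitrary, since only positions act on the tree. *)
have [s [_ s0 sE]] := mu_irr (Lamplighter (conf0 r k l) g^-1%g).
have -> : g = (pos (\prod_(h <- s) h)%g)^-1%g by rewrite -sE invgK.
elim: s w s0 {sE} => [|h s IHs] w s0 wmax.
  by rewrite big_nil /= invg1 tree_act1.
rewrite big_cons /= invgM tree_actM.
have hw : exit_mass (tree_act (pos h)^-1%g w) = exit_mass w.
  by apply: max_atom_step => //; apply: s0; rewrite mem_head.
by rewrite IHs ?hw// => h' h's; apply: s0; rewrite inE h's orbT.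
Qed.

(** Without a maximum there would be an infinite sequence of strictly increasing masses, hence of
    distinct atoms, all at least as heavy as [w]. *)
Lemma max_atom_exists w : (0 < exit_mass w)%R ->
  exists2 w', (0 < exit_mass w')%R &
    (forall w'', exit_mass w'' <= exit_mass w')%R.
Proof.
move=> w0; apply: contrapT => nomax.
have next (u : hat_tree k l) : exists u' : hat_tree k l,
    (0 < exit_mass u -> exit_mass u < exit_mass u')%R.
  apply: contrapT => nu; apply: nomax; exists u.
    by apply: contrapT => u0; apply: nu; exists u => /u0.
  by move=> u'; rewrite leNgt; apply/negP => uu'; apply: nu; exists u'.
have [f fP] := choice next.
pose u n := iter n f w.
have ugt0 n : (0 < exit_mass (u n))%R.
  by elim: n => //= n IHn; apply: lt_trans IHn (fP _ IHn).
have uinc : {homo (exit_mass \o u) : m n / (m < n)%N >-> (m < n)%R}.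
  by apply: homo_ltn => [y x z|n /=]; [exact: lt_trans|exact: fP].
apply: (finitely_many_atoms w0 (w := u)).
  move=> m n mn; apply/eqP; case: ltngtP => // /uinc /=; rewrite mn ltxx//.
by case=> [//|n]; apply/ltW/(uinc 0%N).
Qed.

Lemma exit_mass0 w : exit_mass w = 0%R.
Proof.
apply/eqP; rewrite eq_le exit_mass_ge0 andbT leNgt; apply/negP => w0.
have [v v0 vmax] := max_atom_exists w0.
have [e ve] : exists e, v = End e.
  apply: contrapT => nv; move: v0; rewrite /exit_mass.
  rewrite (_ : Zoo @^-1` _ = set0) ?measure0 ?ltxx//.
  apply/seteqP; split=> // omega /= ov; apply: nv.
  by have [e oe] := Zoo_boundary omega; exists e; rewrite -oe.
subst v.
have q3 : (2 < #|{: letter k l}|)%N.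
  rewrite card_sum card_prod !card_ord card_bool muln2.
  by move: q2; rewrite /branching; case: (k + _)%N.
have [u uinj] := end_orbit_infinite e q3.
by apply: (finitely_many_atoms v0 uinj) => n; rewrite max_atom_orbit.
Qed.

(** Visits at any time are recorded, not only the branch of the limit: this is the event which a
    lamp left on can be shown to imply. *)
Definition hit (v : tree k l) : set Omega :=
  [set omega | exists n,
     prefix (word v) (word (pos (walk 1%g X n omega)))].

Lemma measurable_hit v : measurable (hit v).
Proof.
rewrite (_ : hit v = \bigcup_n walk 1%g (fun i => X i) n @^-1`
    [set g | prefix (word v) (word (pos g))]).
  by apply: bigcupT_measurable => n; exact: measurable_walk.
by apply/seteqP; split=> omega; [move=> [n vn]|move=> [n _ vn]]; exists n.
Qed.

Lemma hit_prefix u v : prefix (word u) (word v) -> hit v `<=` hit u.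
Proof. by move=> uv omega [n vn]; exists n; exact: prefix_trans vn. Qed.

Lemma limit_over_ray (s : ray k l) omega : s 0%N = 1%g ->
  embed (walk 1%g X n omega) @[n --> \oo] --> (Zoo omega : compactification r k
    l) ->
  (forall n, hit (s n) omega) -> (Zoo omega).2 = End (end_of s).
Proof.
move=> s0 lim hits; have [e Ze] := Zoo_boundary omega; rewrite Ze.
have [t t0 et] := root_ray e; rewrite et; congr (End (end_of _)).
apply: ray_eq => m; apply: contrapT => tsm.
have : nbhs (Zoo omega : compactification r k l)
    [set b : compactification r k l | cone (t m) b.2].
  apply/nbhs_compactification => //; exists fset0, (cone (t m)); split => //.
  rewrite Ze et; apply/nbhs_end => //; exists (t m) => //.
  by apply/(geodesic_root _ t0); rewrite ray_size.
move=> /lim[N _ Nlim].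
(* After time [N] the walk stays in the branch of [t m]. The branch of [s (m + L.+1)] is too deep to
   be visited earlier, so it is visited when [t m] is already a prefix; comparing the prefixes of
   length [m] gives [t m = s m]. *)
pose L := (\max_(i < N) size (word (pos (walk 1%g X i omega))))%N.
have [n sn] := hits (m + L.+1)%N.
have [nN|Nn] := ltnP n N.
  have nL : (size (word (pos (walk 1%g X n omega))) <= L)%N.
    exact: (leq_bigmax (F := fun i : 'I_N => size (word (pos (walk 1%g X i
      omega)))) (Ordinal nN)).
  have := leq_trans (size_prefix sn) nL.
  by rewrite ray_size// addnS ltnNge leq_addl.
have /prefix_edist tn := Nlim n Nn; apply: tsm; apply: val_inj.
apply: prefix_size_eq tn _ _; last by rewrite !ray_size.
by apply: prefix_trans sn; apply: ray_prefix => //; exact: leq_addr.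
Qed.

Lemma hit_small (eps : R) : (0 < eps)%R -> exists N, forall v,
  (N <= size (word v))%N -> P (hit v) < eps%:E.
Proof.
move=> eps0; apply: contrapT => H.
pose Q v := eps%:E <= P (hit v).
have Qprefix x y : prefix (word x) (word y) -> Q y -> Q x.
  move=> xy /le_trans; apply; apply: le_measure; rewrite ?inE.
  - exact: measurable_hit.
  - exact: measurable_hit.
  - exact: hit_prefix.
have Qn n : exists2 x, size (word x) = n & Q x.
  apply: contrapT => nQ; apply: H; exists n => v nv.
  rewrite ltNge; apply/negP => Qv; apply: nQ.
  exists (tree_take n v); first exact: size_tree_take.
  exact: Qprefix (prefix_tree_take n v) Qv.
have [s s0 Qs] := koenig Qprefix Qn.
have mcap : measurable (\bigcap_n hit (s n)).
  by apply: bigcapT_measurable => n; exact: measurable_hit.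
have : P (hit (s n)) @[n --> \oo] --> P (\bigcap_n hit (s n)).
  apply: nonincreasing_cvg_mu => //.
  - by rewrite ltey_eq fin_num_measure//; exact: measurable_hit.
  - by move=> n; exact: measurable_hit.
  - by move=> m n mn; apply/subsetPset/hit_prefix/ray_prefix.
have [N [mN N0 subN]] := Zoo_lim.
have -> : P (\bigcap_n hit (s n)) = 0.
  apply/eqP; rewrite eq_le measure_ge0 andbT.
  have mo : measurable (Zoo @^-1` over (End (end_of s))).
    by apply: measurable_Zoo; exact: measurable_over.
  have o0 : P (Zoo @^-1` over (End (end_of s))) = 0 by rewrite exit_massE
    exit_mass0.
  apply: (@le_trans _ _ (P (Zoo @^-1` over (End (end_of s)) `|` N))).
    apply: le_measure; rewrite ?inE//; first exact: measurableU.
    move=> omega H'; have [Nw|nN] := pselect (N omega); [by right|left].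
    apply: limit_over_ray => //; last by move=> n; exact: H'.
    by apply: contrapT => nlim; apply: nN; exact: subN.
  by rewrite -[leRHS](adde0 0) -{1}o0 -N0; exact: measureU2.
have Pn : \forall n \near \oo, eps%:E <= P (hit (s n)) by exact: nearW.
move=> /(cvge_ge Pn).
by rewrite lee_fin leNgt eps0.
Qed.

End exit_points.

(** * Cancellation and bounded range *)

Section cancellation.
Variables k l : nat.
Implicit Types (u w : seq (letter k l)) (x v : tree k l).

(** Here [c] is the number of cancelling pairs: the last [c] letters of [u] meet their inverses at
    the start of [w]. *)
Lemma mulw_cancel u w : reduced u -> exists c,
  [/\ (c <= size u)%N, (c <= size w)%N,
      mulw u w = take (size u - c) u ++ drop c w
    & take c w = invw (drop (size u - c) u)].
Proof.
elim: u => [|a u IHu] ru; first by exists 0%N; rewrite drop0 take0.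
have [c [cu cw /= -> wu]] := IHu (path_sorted ru).
(* The new letter [a] meets [w] only when [u] has been cancelled entirely; otherwise it meets the
   first letter of [u], with which it is reduced. *)
move: cu; rewrite leq_eqVlt => /orP[/eqP cu|cu].
  subst c; rewrite subnn take0 /=; rewrite subnn drop0 in wu.
  case E : (drop _ w) => [|b w'] /=.
    by exists (size u); rewrite leqnSn cw subSnn /= take0 drop0 E.
  case: ifPn => [/eqP ba|ba]; last first.
    by exists (size u); rewrite leqnSn cw subSnn /= take0 drop0 E.
  have uw : (size u < size w)%N by rewrite -subn_gt0 -size_drop E.
  exists (size u).+1; rewrite subnn; split => //.
    by rewrite -addn1 addnC -drop_drop E /= drop0.
  rewrite (take_nth a uw) wu drop0 /invw /= rev_cons; congr rcons.
  by rewrite -[size u]addn0 -nth_drop E /= ba.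
exists c; rewrite subSn; last exact: ltnW.
split => //; first exact: leqW (ltnW cu).
case: u ru cu {IHu wu} => [//|b u] /= /andP[/negPf ba _] cu.
by rewrite subSn//= ba.
Qed.

(** Either the cancellation stops before it reaches [y] inside [x], or it consumes the rest of [x]
    beyond [y], and then [v] begins with the inverse of that rest. *)
Lemma prefix_or_cancel x y (v : tree k l) : prefix (word y) (word x) ->
  prefix (word (tree_take (size (word x) - size (word y)) x^-1%g)) (word v) \/
  prefix (word y) (word (x * v)%g).
Proof.
move=> yx; have [c [cx cv xv vx]] := mulw_cancel (word v) (word_reduced x).
have [m_c|/ltnW cm] := leqP (size (word x) - size (word y)) c; [left|right].
  suff -> : word (tree_take (size (word x) - size (word y)) x^-1%g) =
      take (size (word x) - size (word y)) (word v) by exact: prefix_take.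
  rewrite -(take_takel _ m_c) vx /=.
  rewrite -[in invw (word x)](cat_take_drop (size (word x) - c) (word x)).
  rewrite /invw map_cat rev_cat takel_cat//.
  by rewrite size_rev size_map size_drop subKn.
rewrite /= xv; apply: prefix_trans (prefix_prefix _ _).
apply: (prefix_comparable yx (prefix_take _ _)).
by rewrite size_takel ?leq_subr// leq_subRL// addnC -leq_subRL ?size_prefix//.
Qed.

(** Going from [v] to [x] multiplies by at most [K] letters, which can cancel at most the last [K]
    letters of [v]. *)
Lemma near_prefix x v K : (edist v x <= K)%N ->
  prefix (word (tree_take (size (word v) - K) v)) (word x).
Proof.
move=> vx; have [c [cv cw xE _]] := mulw_cancel (word (v^-1 * x)%g)
  (word_reduced v).
have -> : word x = mulw v (word (v^-1 * x)%g) by rewrite -[in LHS](mulVKg v x).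
rewrite xE; apply: prefix_trans (prefix_prefix _ _).
have le : (size (word v) - K <= size (word v) - c)%N.
  by rewrite leq_sub2l// (leq_trans cw).
by rewrite /= -(take_takel _ le) prefix_take.
Qed.

Lemma end_prefix_or_cancel x y (e : tree_end k l) :
  prefix (word y) (word x) ->
  geodesic (End e) (tree_take (size (word x) - size (word y)) x^-1%g) \/
  geodesic (tree_act x (End e)) y.
Proof.
move=> yx; have [r r0 ->] := root_ray e.
set v := tree_take _ _.
have [rv|nrv] := pselect (geodesic (End (end_of r)) v); [by left|right].
rewrite tree_act_end_of; apply/geodesic_end_of; exists (size (word v)) => n vn.
have [vr|//] := prefix_or_cancel (r n) yx; exfalso; apply: nrv.
apply/(geodesic_root _ r0); apply: val_inj => /=.
apply: prefix_size_eq (ray_prefix r0 vn) vr _.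
by rewrite ray_size.
Qed.

End cancellation.

(** * What a lamp that stays on reveals about the walk *)

Section bounded_range.
Local Open Scope ereal_scope.
Variables (R : realType) (r k l : nat).
Hypothesis q2 : (1 < branching k l)%N.
Local Notation Gamma := (lamplighter r k l).
Variables (mu : probability Gamma R).
Hypothesis mu_range : lamp_range mu < +oo.
Variables (d : measure_display) (Omega : measurableType d)
  (P : probability Omega R) (X : nat -> {RV P >-> Gamma}).
Hypothesis X_law : forall n A, distribution P (X n) A = mu A.
Variable Zoo : {RV P >-> borel r k l}.
Hypothesis Zoo_lim : {ae P, forall omega,
  embed (walk 1%g X n omega) @[n --> \oo] --> (Zoo omega : compactification r k
    l)}.

Lemma lamp_range_bound : exists K : nat, forall (g : Gamma) y,
  0 < mu [set g] -> y \in finsupp (lamps g) ->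
  (minn (edist y 1%g) (edist y (pos g)) <= K)%N.
Proof.
have ub (g : Gamma) y : 0 < mu [set g] -> y \in finsupp (lamps g) ->
    (minn (edist y 1%g) (edist y (pos g)))%:R%:E <= lamp_range mu.
  by move=> mug yg; apply: ereal_sup_ubound; exists g, y.
(* The value [-oo] means that no increment of positive probability switches a lamp, so the bound 0
   holds vacuously. *)
case: (lamp_range mu) mu_range ub => [t _|//|_] ub; last first.
  by exists 0%N => g y mug yg; have := ub g y mug yg; rewrite leeNy_eq.
exists (Num.bound `|t|) => g y mug yg; rewrite -(ler_nat R).
have := ub g y mug yg; rewrite lee_fin => /le_trans; apply.
by rewrite (le_trans (ler_norm t))// ltW// archi_boundP.
Qed.

Lemma increments_support : {ae P, forall omega n, 0 < mu [set X n omega]}.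
Proof.
apply: ae_foralln => n.
pose B := [set g : Gamma | mu [set g] = 0].
exists (X n @^-1` B); split; first exact: measurable_increment.
  transitivity (mu B); first exact: X_law.
  rewrite (_ : B = setT `&` id @^-1` B); last by rewrite setTI.
  rewrite measure_fibers_in//.
  by apply: esum1 => g Bg; rewrite setTI.
by move=> omega /= /negP; rewrite lt0e measure_ge0 andbT negbK => /eqP.
Qed.

(** If the walk avoids the branch, it stays farther than [K] from [v] by [near_prefix], so no step
    can switch the lamp at [v]. This lamp is off at time 0, hence always, hence in the limit, since
    convergence in a discrete coordinate is eventual equality. For [v] of length at most [K] the
    truncated vertex is the root. *)
Lemma limit_lamps K omega v :
  (forall (g : Gamma) y, 0 < mu [set g] -> y \in finsupp (lamps g) ->
    (minn (edist y 1%g) (edist y (pos g)) <= K)%N) ->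
  (forall n, 0 < mu [set X n omega]) ->
  embed (walk 1%g X n omega) @[n --> \oo] --> (Zoo omega : compactification r k
    l) ->
  (Zoo omega).1 v <> 0%R ->
  hit X (tree_take (size (word v) - K) v) omega.
Proof.
move=> Krange supp lim Zv; apply: contrapT => nhit; apply: Zv.
have far n : (K < edist v (pos (walk 1%g X n omega)))%N.
  rewrite ltnNge; apply/negP => near_v; apply: nhit; exists n.
  exact: near_prefix.
have off n : lamps (walk 1%g X n omega) v = 0%R.
  elim: n => [|n IHn]; first by rewrite /walk big_geq// mulg1; exact: conf0E.
  have walkS : walk 1%g X n.+1 omega = (walk 1%g X n omega * X n omega)%g.
    by rewrite /walk big_nat_recr//= mulgA.
  have := far n.+1; rewrite walkS /= conf_addE conf_shiftE IHn add0r => farS.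
  (* Translated by the current position, the two distances bounded by [K] become those from [v] to
     the walk before and after the step; both exceed [K]. *)
  apply: fsfun_dflt; apply/negP => /(Krange _ _ (supp n)).
  rewrite leqNgt => /negP; apply; rewrite leq_min; apply/andP; split.
    by rewrite edistC edist1x; have := far n; rewrite edistC.
  by move: farS; rewrite /edist invgM invgK mulgA.
have : nbhs (Zoo omega : compactification r k l)
    [set b : compactification r k l | b.1 v = (Zoo omega).1 v].
  apply/nbhs_compactification => //; exists [fset v]%fset, setT.
  by split; [exact: filterT|move=> b' b'v _; exact: (b'v v (fset11 v))].
by move=> /lim[N _ /(_ N (leqnn N))] /= <-; rewrite off.
Qed.

Lemma limit_prefix_hit omega v :
  embed (walk 1%g X n omega) @[n --> \oo] --> (Zoo omega : compactification r k
    l) ->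
  geodesic (Zoo omega).2 v -> hit X v omega.
Proof.
move=> lim Zv.
have : nbhs (Zoo omega : compactification r k l)
    [set b : compactification r k l | cone v b.2].
  apply/nbhs_compactification => //; exists fset0, (cone v).
  by split => //; apply: open_nbhs_nbhs; split => //; exact: open_cone.
by move=> /lim[N _ /(_ N (leqnn N))] /prefix_edist; exists N.
Qed.

Lemma limit_lamps_ae : exists K : nat, {ae P, forall omega v,
  (Zoo omega).1 v <> 0%R -> hit X (tree_take (size (word v) - K) v) omega}.
Proof.
have [K Krange] := lamp_range_bound; exists K.
apply: filterS2 increments_support Zoo_lim => omega supp lim v.
exact: limit_lamps.
Qed.

End bounded_range.

(** * The Dirichlet problem *)

Section boundary_functions.
Variables (R : realType) (r k l : nat).
Hypothesis q2 : (1 < branching k l)%N.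
Implicit Types (b : compactification r k l).

Lemma within_continuousP (A : set (compactification r k l))
    (f : compactification r k l -> R) :
  {within A, continuous f} <-> forall b, A b -> forall eps, 0 < eps ->
    exists2 V, nbhs b V & forall b', V b' -> A b' -> `|f b - f b'| < eps.
Proof.
rewrite continuous_subspace_in; split=> [cf b Ab eps eps0|H b].
  have /cvgrPdist_lt /(_ eps eps0) fb := cf b (mem_set Ab).
  have : within A (nbhs b) (fun b' => `|f b - f b'| < eps).
    by rewrite (nbhs_subspace_in Ab); exact: fb.
  by move=> ?; exists [set b' | A b' -> `|f b - f b'| < eps].
rewrite inE => Ab; apply/cvgrPdist_lt => eps eps0.
have [V bV fV] := H b Ab eps eps0.
suff : within A (nbhs b) (fun b' => `|f b - f b'| < eps).
  by rewrite (nbhs_subspace_in Ab).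
by apply: filterS bV => b' Vb' Ab'; exact: fV.
Qed.

Variable f : compactification r k l -> R.
Hypothesis f_cont : {within @boundary r k l, continuous f}.

(** The values of [f] off the boundary are unconstrained; the cut-off makes the function bounded and
    Borel on the whole space. *)
Definition on_boundary : borel r k l -> R := f \_ (@boundary r k l).

Lemma on_boundaryE b : boundary b -> on_boundary b = f b.
Proof. by move=> bb; rewrite /on_boundary patchE mem_set. Qed.

Lemma on_boundary_bounded : exists2 M, 0 <= M & forall b, `|on_boundary b| <= M.
Proof.
have := compact_bounded (continuous_compact f_cont (boundary_compact q2)).
move=> [M [_ bound]]; exists (`|M| + 1) => [|b]; first by rewrite addr_ge0.
rewrite /on_boundary patchE; case: ifPn => [/set_mem bb|_]; last first.
  by rewrite normr0 addr_ge0.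
have M1 : M < `|M| + 1 by rewrite (le_lt_trans (ler_norm M))// ltrDl.
by apply: (bound _ M1); exists b.
Qed.

Lemma measurable_on_boundary : measurable_fun setT on_boundary.
Proof.
have mD : measurable (@boundary r k l : set (borel r k l)).
  by apply: closed_borel; exact: boundary_closed.
apply: (proj1 (measurable_restrictT (f : borel r k l -> R) mD)).
apply: (measurability _ (RGenOpens.measurableE R)) => //.
move=> _ [_ [x [y ->]] <-].
have /open_subspaceP[V oV VE] := (continuousP
  (f : subspace (@boundary r k l) -> R)).1 f_cont _ (@interval_open _ (BRight
    x) (BLeft y) isT isT).
rewrite setIC -VE; apply: measurableI => //; exact: open_borel.
Qed.

End boundary_functions.

(** * The Poisson integral: harmonicity, boundary limits, continuity in the lamps *)

Section poisson_integral.
Local Open Scope ereal_scope.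
Variables (R : realType) (r k l : nat).
Hypothesis q2 : (1 < branching k l)%N.
Local Notation Gamma := (lamplighter r k l).
Variables (mu : probability Gamma R).
Hypothesis mu_irr : irreducible mu.
Hypothesis mu_range : lamp_range mu < +oo.
Variables (d : measure_display) (Omega : measurableType d)
  (P : probability Omega R) (X : nat -> {RV P >-> Gamma}).
Hypothesis X_law : forall n A, distribution P (X n) A = mu A.
Hypothesis X_indep : independent X.
Variable Zoo : {RV P >-> borel r k l}.
Hypothesis Zoo_boundary : forall omega, boundary (Zoo omega).
Hypothesis Zoo_lim : {ae P, forall omega,
  embed (walk 1%g X n omega) @[n --> \oo] --> (Zoo omega : compactification r k
    l)}.
Variable f : compactification r k l -> R.
Hypothesis f_cont : {within @boundary r k l, continuous f}.

(** Integrating over the sample space keeps the limit [Zoo] explicit, for the first-step identity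
    and for estimates on events; [integral_translate] recovers the integral against the translated
    law. *)
Definition poisson (g : Gamma) : R :=
  fine (\int[P]_omega (on_boundary f (act g (Zoo omega)))%:E).

Lemma measurable_integrand g :
  measurable_fun setT (fun omega => on_boundary f (act g (Zoo omega))).
Proof.
exact: (measurableT_comp (measurable_on_boundary q2 f_cont)
  (measurable_act_Zoo q2 Zoo g)).
Qed.

Lemma integrable_bounded (F : Omega -> R) (M : R) : measurable_fun setT F ->
  (forall omega, `|F omega| <= M)%R ->
  P.-integrable setT (EFin \o F).
Proof.
move=> mF FM; apply: (@le_integrable _ _ _ P setT measurableT _ (cst M%:E)).
- exact/measurable_EFinP.
- by move=> omega _ /=; rewrite lee_fin (le_trans (FM omega))// ler_norm.
- exact: finite_measure_integrable_cst.
Qed.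

Lemma poissonE g :
  \int[P]_omega (on_boundary f (act g (Zoo omega)))%:E = (poisson g)%:E.
Proof.
have [M M0 fM] := on_boundary_bounded q2 f_cont.
rewrite fineK//; apply: integrable_fin_num => //.
by apply: (@integrable_bounded _ M) => //; exact: measurable_integrand.
Qed.

Lemma integral_translate g :
  fine (\int[translate (distribution P Zoo) g]_(b in @boundary r k l) (f b)%:E)
    =
  poisson g.
Proof.
have [M M0 fM] := on_boundary_bounded q2 f_cont.
have -> : translate (distribution P Zoo) g =
    pushforward P (fun omega => act g (Zoo omega) : borel r k l).
  by rewrite translateE.
have mD : measurable (@boundary r k l : set (borel r k l)).
  by apply: closed_borel; exact: boundary_closed.
have mf : measurable_fun setT (EFin \o on_boundary f).
  by apply/measurable_EFinP; exact: measurable_on_boundary.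
have preim : (fun omega => act g (Zoo omega)) @^-1` @boundary r k l = setT.
  by apply/seteqP; split=> // omega _; exact: act_boundary.
have intf : P.-integrable ((fun omega => act g (Zoo omega)) @^-1` @boundary r k
  l)
    ((EFin \o on_boundary f) \o (fun omega => act g (Zoo omega))).
  rewrite preim; apply: (@integrable_bounded _ M) => //.
  exact: measurable_integrand.
have := integral_pushforward (measurable_act_Zoo q2 Zoo g) mf intf mD.
rewrite preim /poisson => E; congr fine; apply: etrans E.
apply: eq_integral; first exact: measurable_act_Zoo.
by move=> b /set_mem bb /=; rewrite on_boundaryE.
Qed.

Lemma poisson_shift (M : R) g : (0 <= M)%R ->
  (forall b, `|on_boundary f b| <= M)%R ->
  \int[P]_omega (on_boundary f (act g (Zoo omega)) + M)%:E = (poisson g + M)%:E.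
Proof.
move=> M0 fM; under eq_integral do rewrite EFinD.
rewrite integralD//; first last.
- exact: finite_measure_integrable_cst.
- by apply: (@integrable_bounded _ M) => //; exact: measurable_integrand.
by rewrite poissonE integral_cst// [X in _ * X](_ : _ = 1) ?mule1//;
  exact: probability_setT.
Qed.

Lemma esum_law (c : R) : (0 <= c)%R ->
  \esum_(x in [set: Gamma]) (c%:E * mu [set x]) = c%:E.
Proof.
move=> c0; rewrite ge0_esumZl//.
transitivity (c%:E * mu (setT `&` id @^-1` [set: Gamma])).
  rewrite measure_fibers_in//; congr (_ * _); apply: eq_esum => x _.
  by rewrite setTI.
by rewrite setTI [X in _ * X](_ : _ = 1) ?mule1//; exact: probability_setT.
Qed.

(** Adding the bound [M] makes the integrand nonnegative, so it can be split along the values of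
    [X 0]; [first_step_integral] evaluates each piece. *)
Lemma esum_first_step (M : R) g : (0 <= M)%R ->
  (forall b, `|on_boundary f b| <= M)%R ->
  \esum_(x in [set: Gamma]) (mu [set x] * (poisson (g * x)%g + M)%:E) =
  (poisson g + M)%:E.
Proof.
move=> M0 fM; rewrite -poisson_shift//.
have psi0 b : 0 <= (on_boundary f b + M)%:E.
  by rewrite lee_fin -lerBlDr sub0r; have := fM b; rewrite ler_norml => /andP[].
pose psi (b : borel r k l) := (on_boundary f (act g b) + M)%:E.
have mpsi : measurable_fun setT psi.
  apply/measurable_EFinP; apply: measurable_funD => //.
  exact: measurableT_comp (measurable_on_boundary q2 f_cont) (measurable_act q2
    g).
rewrite (@ge0_integral_fibers _ _ _ P _ (X 0))//; last first.
- exact: (measurableT_comp mpsi (measurable_funPT Zoo)).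
- by move=> x; exact: measurable_increment.
apply: eq_esum => x _; rewrite setTI.
rewrite (first_step_integral (mu := mu) q2 X_law X_indep Zoo_lim x mpsi);
  last first.
  by move=> b; exact: psi0.
congr (_ * _); rewrite -poisson_shift//.
by apply: eq_integral => omega _; rewrite /psi actM.
Qed.

Lemma poisson_harmonic : harmonic_fun mu poisson.
Proof.
have [M M0 fM] := on_boundary_bounded q2 f_cont.
move=> g u.
(* The signed family is the difference of two nonnegative ones with known finite sums, which yields
   both the summability and the equation. *)
pose F g' := (transition mu g g' * (poisson g' + M))%:E.
pose G g' := (transition mu g g' * M)%:E.
have shift (a : Gamma -> \bar R) :
    \esum_(g' in [set: Gamma]) a g' = \esum_(x in [set: Gamma]) a (g * x)%g.
  apply: reindex_esum; split=> [//||g' _].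
    by move=> x y _ _; exact: mulgI.
  by exists (g^-1 * g')%g => //; rewrite mulVKg.
have trE x : transition mu g (g * x)%g = fine (mu [set x]).
  by rewrite /transition mulKg.
have pM g' : (0 <= poisson g' + M)%R.
  rewrite -lee_fin -poisson_shift//; apply: integral_ge0 => omega _.
  rewrite lee_fin -lerBlDr sub0r.
  by have := fM (act g' (Zoo omega)); rewrite ler_norml => /andP[].
have tr0 g' : (0 <= transition mu g g')%R by exact: fine_ge0.
have F0 g' : 0 <= F g' by rewrite lee_fin mulr_ge0.
have G0 g' : 0 <= G g' by rewrite lee_fin mulr_ge0.
have sumF : \esum_(g' in [set: Gamma]) F g' = (poisson g + M)%:E.
  rewrite shift -esum_first_step//; apply: eq_esum => x _.
  by rewrite /F trE EFinM fineK// fin_num_measure.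
have sumG : \esum_(g' in [set: Gamma]) G g' = M%:E.
  rewrite shift -esum_law//; apply: eq_esum => x _.
  by rewrite /G trE EFinM fineK ?fin_num_measure// muleC.
have summF : summable [set: Gamma] F.
  rewrite /summable; under eq_esum do rewrite gee0_abs//.
  by rewrite sumF ltry.
have summG : summable [set: Gamma] G.
  rewrite /summable; under eq_esum do rewrite gee0_abs//.
  by rewrite sumG ltry.
have -> : u = F \- G.
  by apply/funext => g' /=; rewrite /u /F /G -EFinB mulrDr addrK.
split; first exact: summableB.
by rewrite esumB// sumF sumG -EFinB addrK.
Qed.

Lemma hit_union_le (vs : seq (tree k l)) (delta : R) :
  (forall v, v \in vs -> P (hit X v) < delta%:E) ->
  P (\big[setU/set0]_(v <- vs) hit X v) <= ((size vs)%:R * delta)%:E.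
Proof.
elim: vs => [|v vs IHvs] small.
  by rewrite big_nil measure0 mul0r.
have mU s : measurable (\big[setU/set0]_(v <- s) hit X v).
  by apply: bigsetU_measurable => u _; exact: measurable_hit.
rewrite big_cons /= -natr1 mulrDl mul1r addrC EFinD.
apply: (@le_trans _ _ (P (hit X v) + P (\big[setU/set0]_(v <- vs) hit X v))).
  by apply: measureU2 => //; exact: measurable_hit.
apply: leeD; first by apply/ltW/small; rewrite mem_head.
by apply: IHvs => u uvs; apply: small; rewrite inE uvs orbT.
Qed.

(** The integrand differs from [c] by at most [e] off [B], and by at most [M + M] on [B]. *)
Lemma poisson_close (c M e delta : R) (B : set Omega) g : (0 <= e)%R ->
  (`|c| <= M)%R -> (forall b, `|on_boundary f b| <= M)%R ->
  measurable B -> P B <= delta%:E ->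
  {ae P, forall omega, ~ B omega ->
    (`|c - on_boundary f (act g (Zoo omega))| <= e)%R} ->
  (`|c - poisson g| <= e + (M + M) * delta)%R.
Proof.
move=> e0 cM fM mB PB close.
have M0 : (0 <= M)%R by rewrite (le_trans _ cM).
have mf := measurable_integrand g.
have mcf : measurable_fun setT
    (fun omega => (c - on_boundary f (act g (Zoo omega)))%:E).
  by apply/measurable_EFinP; exact: measurable_funB.
have E : \int[P]_omega (c - on_boundary f (act g (Zoo omega)))%:E =
    (c - poisson g)%:E.
  under eq_integral do rewrite EFinB.
  rewrite integralB//; last 2 first.
  - exact: finite_measure_integrable_cst.
  - exact: (@integrable_bounded _ M).
  rewrite poissonE integral_cst// [X in _ * X](_ : _ = 1) ?mule1//.
  exact: probability_setT.
rewrite -lee_fin -abse_EFin -E;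
  apply: le_trans (le_abse_integral _ _ _) _ => //.
have ind0 omega : 0 <= (M + M)%:E * (\1_B omega)%:E.
  by rewrite -EFinM lee_fin mulr_ge0// addr_ge0.
apply: (@le_trans _ _ (\int[P]_omega (e%:E + (M + M)%:E * (\1_B omega)%:E))).
  apply: ae_ge0_le_integral => //.
  - exact: measurableT_comp.
  - by move=> omega _; rewrite adde_ge0// lee_fin.
  - apply: emeasurable_funD => //; apply: measurable_funeM.
    by apply/measurable_EFinP; exact: measurable_indic.
  - apply: filterS close => omega close _; rewrite indicE lee_fin.
    have [Bo|nBo] := pselect (B omega).
      rewrite mem_set// mulr1 (le_trans (ler_normB _ _))//.
      by rewrite -[leLHS]add0r lerD// lerD.
    by rewrite memNset// mulr0 addr0; exact: close.
rewrite ge0_integralD//; last first.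
  by apply: measurable_funeM; apply/measurable_EFinP; exact: measurable_indic.
rewrite integral_cst// [X in e%:E * X](_ : _ = 1) ?mule1;
  last exact: probability_setT.
rewrite ge0_integralZl//; last first.
- by rewrite lee_fin addr_ge0.
- by apply/measurable_EFinP; exact: measurable_indic.
rewrite integral_indic// setIT [leRHS]EFinD [X in _ <= _ + X]EFinM leeD2l//.
by rewrite lee_wpmul2l// lee_fin addr_ge0.
Qed.

Lemma poisson_limit b (eps : R) : boundary b -> (0 < eps)%R ->
  exists2 U, nbhs b U & forall g, U (embed g) -> (`|f b - poisson g| < eps)%R.
Proof.
move=> bb eps0; have [M M0 fM] := on_boundary_bounded q2 f_cont.
have [V bV fV] := (within_continuousP _ _).1 f_cont b bb (eps / 2)%R (divr_gt0
  eps0 (ltr0Sn _ _)).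
have [F [W [bW FWV]]] := (nbhs_compactification b V).1 bV.
have [e be] := bb; move: bW; rewrite be => /(nbhs_end q2)[x0 ex0 x0W].
have [K lampsK] := limit_lamps_ae mu_range X_law Zoo_lim.
(* There are [n] bad branches: one for the end and one for each lamp in [F]. With this [delta] the
   error [(M + M) * (n * delta)] equals [eps / 2 * (M / (M + 1))], which is below [eps / 2] even for
   [M = 0]. *)
pose n := (#|` F|.+1)%:R : R.
have n0 : (0 < n)%R by rewrite ltr0n.
pose delta := (eps / (4 * (M + 1)) / n)%R.
have M1 : (0 < M + 1)%R by rewrite ltr_wpDl.
have delta0 : (0 < delta)%R by rewrite !divr_gt0// mulr_gt0.
have [N smallN] := hit_small q2 mu_irr X_law X_indep Zoo_boundary Zoo_lim
  delta0.
(* The summands [size (word x0) + N] give [v1] length at least [N]. For [vy y], the product of the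
   inverse of [x] with [y] loses at most [size (word y)] letters and the truncation [K] more; the
   last two summands make up for these. *)
pose L := (size (word x0) + N + K + \max_(y <- F) size (word y))%N.
have [x1 x1L ex1] := geodesic_at e L.
exists (cylinder F b.1 (cone x1)).
  apply/nbhs_compactification => //; exists F, (cone x1); split => //.
  by apply: open_nbhs_nbhs; split; [exact: open_cone|rewrite be].
move=> g [gF /prefix_edist gx1]; set x := pos g in gx1.
have Lx : (L <= size (word x))%N by rewrite -x1L size_prefix.
have x0x : prefix (word x0) (word x).
  apply: prefix_trans gx1; apply: geodesic_total ex1 ex0 _.
  by rewrite x1L /L -!addnA leq_addr.
pose v1 := tree_take (size (word x) - size (word x0)) x^-1%g.
pose vy y := tree_take (size (word (x^-1 * y)%g) - K) (x^-1 * y)%g.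
pose vs := v1 :: [seq vy y | y <- F].
have small v : v \in vs -> P (hit X v) < delta%:E.
  rewrite inE => /orP[/eqP ->|/mapP[y yF ->]]; apply: smallN.
    rewrite size_tree_take ?size_invg ?leq_subr// leq_subRL ?size_prefix//.
    by rewrite (leq_trans _ Lx)// /L -addnA leq_addr.
  rewrite size_tree_take ?leq_subr//.
  have yL : (size (word y) <= \max_(y <- F) size (word y))%N.
    by apply: (@leq_bigmax_seq _ _ _ (fun y : tree k l => size (word y))).
  have := size_mul_ge y^-1%g x; rewrite size_invg -(size_invg (y^-1 * x)%g).
  rewrite invgM invgK => xy.
  have arith a n' k' m sx sy s : (a + n' + k' + m <= sx -> sy <= m ->
    sx <= sy + s -> n' <= s - k')%N by clear; lia.
  exact: arith Lx yL xy.
have := @poisson_close (f b) M (eps / 2)%R (n * delta)%R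
  (\big[setU/set0]_(v <- vs) hit X v) g.
have -> : (eps / 2 + (M + M) * (n * delta) =
    eps / 2 + eps / 2 * (M / (M + 1)))%R.
  rewrite /delta; field.
  by rewrite gt_eqF//= gt_eqF.
move=> close; apply: le_lt_trans (close _ _ _ _ _ _) _ => //.
- by rewrite divr_ge0// ltW.
- by rewrite -on_boundaryE.
- by apply: bigsetU_measurable => u _; exact: measurable_hit.
- have -> : n = ((size vs)%:R)%R by rewrite /= size_map.
  exact: hit_union_le.
- apply: filterS2 lampsK Zoo_lim => omega lampsK lim nB.
  have nhit v : v \in vs -> ~ hit X v omega.
    by move=> vvs vB; apply: nB; rewrite -bigcup_seq; exists v.
  have bg := act_boundary g (Zoo_boundary omega).
  rewrite on_boundaryE//; apply/ltW/fV => //; apply: FWV => [y yF|].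
    rewrite /= -/x; have -> : (Zoo omega).1 (x^-1 * y)%g = 0%R.
      apply: contrapT => /lampsK; apply: nhit.
      by rewrite inE; apply/orP; right; apply/mapP; exists y.
    by rewrite addr0; exact: gF.
  apply: x0W; have [e' Ze'] := Zoo_boundary omega.
  rewrite /act -/x Ze'.
  have [Zv1|//] := end_prefix_or_cancel e' x0x; exfalso.
  apply: (nhit v1); first by rewrite mem_head.
  by apply: (limit_prefix_hit q2 lim); rewrite Ze'.
- rewrite [ltRHS](splitr eps) ltrD2l gtr_pMr ?divr_gt0//.
  by rewrite ltr_pdivrMr// mul1r ltrDl.
Qed.

(** Needed for continuity at group points. If it failed, there would be a sequence at the same
    position agreeing with [g] on ever larger finite sets of lamps, with values staying [eps] away;
    but its images of [Zoo] converge pointwise to that of [g], and dominated convergence applies. *)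
Lemma poisson_lamps g (eps : R) : (0 < eps)%R ->
  exists F : {fset tree k l}, forall g', pos g' = pos g ->
    {in F, lamps g' =1 lamps g} -> (`|poisson g - poisson g'| < eps)%R.
Proof.
move=> eps0; apply: contrapT => H.
have [M M0 fM] := on_boundary_bounded q2 f_cont.
(* The vertices with code below [n]: these finite sets exhaust the tree. *)
pose F n : {fset tree k l} :=
  [fset y in pmap (@choice.unpickle (tree k l)) (iota 0 n)]%fset.
have inF n y : (choice.pickle y < n)%N -> y \in F n.
  move=> yn; rewrite !inE mem_pmap; apply/mapP; exists (choice.pickle y).
    by rewrite mem_iota.
  by rewrite choice.pickleK.
have far n : exists g', [/\ pos g' = pos g, {in F n, lamps g' =1 lamps g}
    & (eps <= `|poisson g - poisson g'|)%R].
  apply: contrapT => nfar; apply: H; exists (F n) => g' gp gF.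
  by rewrite ltNge; apply/negP => le; apply: nfar; exists g'.
have [g_ g_P] := choice far.
have [] := @dominated_convergence _ Omega R P setT measurableT
  (fun n omega => (on_boundary f (act (g_ n) (Zoo omega)))%:E)
  (fun omega => (on_boundary f (act g (Zoo omega)))%:E) (cst M%:E).
- by move=> n; apply/measurable_EFinP; exact: measurable_integrand.
- by apply/measurable_EFinP; exact: measurable_integrand.
- apply: aeW => omega _; apply: cvg_EFin; first exact: nearW.
  have bg h := act_boundary h (Zoo_boundary omega).
  apply/cvgrPdist_lt => e e0.
  have [V gV fV] := (within_continuousP _ _).1 f_cont _ (bg g) e e0.
  have [G [W [gW GWV]]] := (nbhs_compactification _ V).1 gV.
  exists (\max_(y <- G) choice.pickle y).+1 => // n /= Gn.
  rewrite !on_boundaryE//; apply: fV => //.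
  have [gp gF _] := g_P n.
  apply: GWV => [y yG|]; last by rewrite /= gp; exact: nbhs_singleton gW.
  rewrite /= gp gF//; apply: inF; apply: leq_ltn_trans Gn.
  by apply: (@leq_bigmax_seq _ _ _ (fun y : tree k l => choice.pickle y)).
- exact: finite_measure_integrable_cst.
- by apply: aeW => omega n _; rewrite abse_EFin lee_fin.
move=> _ _; rewrite poissonE; under eq_fun => n do rewrite poissonE.
move=> /fine_cvgP[_] /cvgrPdist_lt /(_ eps eps0)[n _ /(_ n (leqnn n))] /=.
by rewrite ltNge; have [_ _ ->] := g_P n.
Qed.

End poisson_integral.

Lemma embed_inj r k l : injective (@embed r k l).
Proof.
move=> g h /(congr1 (fun b : compactification r k l => b)) [gh1 gh2].
by apply: lamplighter_eq => // y; have := congr1 (fun z => z y) gh1.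
Qed.

Theorem theorem4p4 (R : realType) (q r k l : nat)
  (q_ge2 : (2 <= q)%N) (r_ge2 : (2 <= r)%N) (degree : (k + l.*2)%N = q.+1)
  (mu : probability (lamplighter r k l) R)
  (mu_irr : irreducible mu) (mu_range : (lamp_range mu < +oo)%E)
  (d : measure_display) (Omega : measurableType d) (P : probability Omega R)
  (X : nat -> {RV P >-> lamplighter r k l})
  (X_law : forall n A, distribution P (X n) A = mu A)
  (X_indep : independent X)
  (Zoo : {RV P >-> borel r k l})
  (Zoo_boundary : forall omega, boundary (Zoo omega))
  (Zoo_lim : {ae P, forall omega,
     embed (walk 1%g X n omega) @[n --> \oo] --> (Zoo omega : compactification r k l)})
  (f : compactification r k l -> R)
  (f_cont : {within @boundary r k l, continuous f}) :
  let nu := distribution P Zoo in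
  let h := fun g : lamplighter r k l =>
    fine (\int[translate nu g]_(b in @boundary r k l) (f b)%:E) in
  [/\ harmonic_fun mu h,
      forall b, boundary b -> h @ group_nbhs b --> f b
    & exists F : compactification r k l -> R,
      [/\ {within range (@embed r k l) `|` @boundary r k l, continuous F},
          {in @boundary r k l, F =1 f}
        & harmonic_fun mu (F \o @embed r k l)]].
Proof.
move=> nu h.
have q2 : (1 < branching k l)%N by rewrite /branching degree.
have -> : h = poisson Zoo f.
  by apply/funext => g; exact: integral_translate.
have harm : harmonic_fun mu (poisson Zoo f) by exact: poisson_harmonic Zoo_lim
  _ f_cont.
have limit b (eps : R) (bb : boundary b) (eps0 : 0 < eps) :=
  poisson_limit q2 mu_irr mu_range X_law X_indep Zoo_boundary Zoo_lim f_cont bb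
    eps0.
split=> // [b bb A /nbhs_ballP[eps /= eps0 fA]|].
  have [U bU Uf] := limit b eps bb eps0.
  by exists U => // g Ug; apply: fA; exact: Uf.
(* A group point is recovered from its image, as [embed] is injective. Elsewhere off the boundary
   [xget] falls back on [1%g]; such points lie outside the set on which continuity is claimed. *)
pose F b := if `[< boundary b >] then f b
  else poisson Zoo f (xget 1%g [set g | embed g = b]).
have Fb b : boundary b -> F b = f b by move=> bb; rewrite /F asboolT.
have Fg g : F (embed g) = poisson Zoo f g.
  rewrite /F asboolF; last by move=> [e].
  congr (poisson Zoo f _); apply: embed_inj.
  exact: (@xgetPex _ 1%g [set g' | embed g' = embed g] (ex_intro _ g erefl)).
exists F; split; last 1 first.
- by rewrite (_ : F \o _ = poisson Zoo f)//; apply/funext => g; exact: Fg.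
- apply/within_continuousP => b + eps eps0 => -[[g _ <-]|bb].
    (* Vertices are isolated in the tree part, so the chosen neighbourhood contains no boundary
       point, and its group points share the position of [g]. *)
    have [G GH] := poisson_lamps q2 Zoo_boundary f_cont g eps0.
    exists (cylinder G (lamps g) [set Vertex (pos g)]).
      apply/nbhs_compactification; exists G, [set Vertex (pos g)].
      by split; [exact/nbhs_vertex|move=> b' b'G b'g; split].
    move=> b' [gG gp] [[g' _ g'E]|[e be]]; last by move: gp; rewrite be.
    by subst b'; rewrite !Fg; apply: GH => //; case: gp.
  have [V bV fV] := (within_continuousP _ f).1 f_cont b bb eps eps0.
  have [U bU Uf] := limit b eps bb eps0.
  exists (U `&` V); first exact: filterI.
  move=> b' [Ub' Vb'] [[g _ gE]|bb']; last by rewrite !Fb//; exact: fV.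
  by rewrite -gE Fg Fb//; apply: Uf; rewrite gE.
- by move=> b; rewrite inE; exact: Fb.
Qed.
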